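(* Let $\varphi\in C^1(\mathbb{R})$ be $L$-periodic, strictly positive and satisfying the compatibility condition $\int_0^L\varphi(s)\,ds=1$. If, moreover, $\varphi$ satisfies the condition $$ \max_{s\in[0,L]}\left|\frac{\varphi'(s)}{\varphi^2(s)}\right|\le 2\pi , $$ then the operator $\mathcal{T}$ (defined in the context) is surjective, in the sense that $\varphi$ is attained: there is $f\in\mathscr{F}$ with $\mathcal{T}(f)=\varphi$.
   Context: Fix $\alpha\in(0,1)$ and two distinct points $\zeta_c,\zeta_b\in\mathbb{C}$. Let $\mathscr{O}$ be the set of all bounded simply connected domains $\Omega\subset\mathbb{C}$ of class $C^{1,\alpha}$ (the boundary is locally the graph of a $C^{1,\alpha}$ function) such that $\zeta_c\in\Omega$ and $\zeta_b\in\partial\Omega$. With $D$ the open unit disk centered at $0$, $\mathscr{O}$ is identified with the class $\mathscr{F}$ of all one-to-one analytic mappings $f$ of $D$, $f\in C^{1,\alpha}(\overline D)$, such that $f(0)=\zeta_c$ and $f(1)=\zeta_b$, via $\Omega=f(D)$. The operator $\mathcal{T}$ associates to each $\Omega\in\mathscr{O}$ (equivalently to each $f\in\mathscr{F}$) the interior normal derivative $\frac{\partial U}{\partial\nu}$ on $\partial\Omega$, as a function of the arclength $s\in[0,|\partial\Omega|]$ measured counterclockwise on $\partial\Omega$ starting from $\zeta_b$, where $U$ is the Green's function of $\Omega$ with pole at $\zeta_c$, that is, the solution of $-\Delta U=\delta_{\zeta_c}$ in $\Omega$, $U=0$ on $\partial\Omega$ ($\delta_{\zeta_c}$ is the Dirac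 delta at $\zeta_c$, $\nu$ the interior unit normal, $|\partial\Omega|$ the length of $\partial\Omega$). In terms of $f$, $\mathcal{T}(f)$ is given parametrically by $s=\int_0^\theta|f'(e^{it})|\,dt$, $\mathcal{T}(f)=\frac{1}{2\pi|f'(e^{i\theta})|}$, $\theta\in[0,2\pi]$.
   Formalization: With both points fixed the claim fails (φ=1/L forces L=2π|ζ_b−ζ_c|), so the condition f(1)=ζ_b is replaced by f(1)=ζ_c+r(ζ_b−ζ_c) for some r>0, which φ determines; the printed claim is the case r=1. *)

(* Defs.v *)
From Stdlib Require Import Reals.
From Coquelicot Require Import Coquelicot.

Open Scope R_scope.

Definition unit_disc (z : C) : Prop := Cmod z < 1.
Definition closed_unit_disc (z : C) : Prop := Cmod z <= 1.

Definition cis (t : R) : C := (cos t, sin t).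

Definition one_to_one_on (A : C -> Prop) (f : C -> C) : Prop :=
  forall z w : C, A z -> A w -> f z = f w -> z = w.

Definition holder_on (A : C -> Prop) (alpha : R) (g : C -> C) : Prop :=
  exists K : R, forall z w : C, A z -> A w -> z <> w ->
    Cmod (g z - g w) <= K * Rpower (Cmod (z - w)) alpha.

(* [f'] stands for the derivative of [f] on the open disc together with its
   extension to the closed disc. [holder_on] forces this extension to be
   continuous, hence [f'] is determined by [f] on the closed disc. Values of
   [f] and [f'] outside the closed disc are irrelevant. *)
Definition analytic_C1alpha (alpha : R) (f f' : C -> C) : Prop :=
  (forall z : C, unit_disc z -> is_derive f z (f' z)) /\
  continuous_on closed_unit_disc f /\
  holder_on closed_unit_disc alpha f'.

(* Membership in this class makes f(D) a C^{1,alpha} Jordan domain containing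
   [zeta_c], with [zeta_b] on its boundary. This is why injectivity is required
   up to the boundary (no self-contact of f(bd D)) and f' must not vanish
   there (no cusp or corner). Conversely, by the theorems of Caratheodory and
   Kellogg-Warschawski, the Riemann maps of such domains satisfy both. *)
Definition class_F (alpha : R) (zeta_c zeta_b : C) (f f' : C -> C) : Prop :=
  analytic_C1alpha alpha f f' /\
  one_to_one_on closed_unit_disc f /\
  (forall z : C, closed_unit_disc z -> f' z <> RtoC 0) /\
  f (RtoC 0) = zeta_c /\
  f (RtoC 1) = zeta_b.

Definition arclength (f' : C -> C) (theta : R) : R :=
  RInt (fun t => Cmod (f' (cis t))) 0 theta.

(* T(f) = phi as functions of the arclength on [0, |bd Omega|], where
   |bd Omega| = L; T(f) is the function given parametrically by
   s = arclength f' theta, value 1 / (2 pi |f'(e^{i theta})|). *)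
Definition T_equals (f' : C -> C) (L : R) (phi : R -> R) : Prop :=
  arclength f' (2 * PI) = L /\
  forall theta : R, 0 <= theta <= 2 * PI ->
    phi (arclength f' theta) = 1 / (2 * PI * Cmod (f' (cis theta))).

Definition C1_on_R (phi : R -> R) : Prop :=
  forall s : R, ex_derive phi s /\ continuous (Derive phi) s.

(* The modulus of f' on the unit circle, hence |f(1) - f(0)|, is determined by
   T(f). For instance T(f) = 1/L forces f(z) = zeta_c + a z with |a| = L/(2 pi).
   Hence only the direction of zeta_b - zeta_c, not its length, is free once
   T(f) is prescribed: the boundary point ranges over the open ray from
   [zeta_c] through [zeta_b]. *)
Definition ray_point (zeta_c zeta_b : C) (r : R) : C :=
  (zeta_c + RtoC r * (zeta_b - zeta_c))%C.

(* Main.v *)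
Require Import Defs.
From Stdlib Require Import Reals Lra Lia Psatz.
From Coquelicot Require Import Coquelicot.
Open Scope R_scope.

(** Put [rho(th) = - ln (2 pi phi(s(th)))], where [th = 2 pi int_0^s phi]. The bound on [phi'/phi^2]
    says exactly that the [2 pi]-periodic function [rho] is 1-Lipschitz. Let [h] be the Schwarz
    integral of [rho], so that [Re h = rho] on the unit circle, and take [f' = u exp(h)], [|u| = 1].
    The conjugate function of a 1-Lipschitz function is bounded by
    [1/(2 pi) int_{-pi}^{pi} |x cot (x/2)| dx <= 2 - pi^2/18 < pi/2], whence [Re exp(h)] is bounded below
    by a positive constant and [f] is univalent up to the boundary (Noshiro-Warschawski). Since
    [|h(z) - h(w)| <= C |z - w| log (1/(1 - |w|))], [h] is [alpha]-Hoelder for every [alpha < 1]. *)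

(** * Complex-valued functions of a real variable *)

(** Equality is allowed in the bound on phi'/phi^2, so the Lipschitz constant of [rho] is no better
    than 1, and the crude estimate |x cot (x/2)| <= 2 would only bound the conjugate function by 2 >
    pi/2. One more term of the expansion, x cot (x/2) <= 2 - x^2/6, averages over [-pi, pi] to 2 -
    pi^2/18, which is below 3/2. The strictly positive lower bound on Re exp(h) is what carries
    injectivity up to the circle. The other estimates rest on one cancellation. Replacing rho(t) by
    rho(t) - rho(th), with th the argument of z, is controlled because the integrals of the kernels
    are known exactly; then |t - th| <= 6 |1 - z e^{-it}| absorbs one power of the singular kernel,
    uniformly as z approaches the circle. The only contour integral evaluated is Cauchy's formula
    for the constant 1. The primitive of exp(h) is taken along rays, and a direct estimate under the
    integral sign replaces path independence. *)

Lemma Cmod_minus_sym (z w : C) : Cmod (z - w) = Cmod (w - z).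
Proof. rewrite <- Cmod_opp. f_equal. ring. Qed.

Lemma Cmod_minus_triangle (x y z : C) :
  Cmod (x - z) <= Cmod (x - y) + Cmod (y - z).
Proof. replace (x - z)%C with ((x - y) + (y - z))%C by ring. apply Cmod_triangle. Qed.

Lemma Cmod_le_plus_minus (z w : C) : Cmod z <= Cmod w + Cmod (z - w).
Proof. replace z with (w + (z - w))%C at 1 by ring. apply Cmod_triangle. Qed.

Lemma Cmod_fst (z : C) : Rabs (fst z) <= Cmod z.
Proof. eapply Rle_trans; [|apply Rmax_Cmod]; apply Rmax_l. Qed.

Lemma Cmod_snd (z : C) : Rabs (snd z) <= Cmod z.
Proof. eapply Rle_trans; [|apply Rmax_Cmod]; apply Rmax_r. Qed.

Lemma Cmod_le_fst_snd (z : C) : Cmod z <= Rabs (fst z) + Rabs (snd z).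
Proof.
  assert (E : z = (RtoC (fst z) + Ci * RtoC (snd z))%C)
    by (apply injective_projections; simpl; ring).
  rewrite E at 1. eapply Rle_trans; [apply Cmod_triangle|].
  rewrite Cmod_mult, Cmod_Ci, !Cmod_R; lra.
Qed.

Lemma Cmod_neq_0 (z : C) : 0 < Cmod z -> z <> RtoC 0.
Proof. apply Cmod_gt_0. Qed.

Lemma Cmod_sqr (z : C) : Cmod z * Cmod z = fst z * fst z + snd z * snd z.
Proof. generalize (Cmod2_alt z); unfold Re, Im; nra. Qed.

Lemma cis_plus (a b : R) : cis (a + b) = (cis a * cis b)%C.
Proof.
  unfold cis; apply injective_projections; simpl.
  - apply cos_plus.
  - rewrite sin_plus; ring.
Qed.

Lemma cis_0 : cis 0 = RtoC 1.
Proof. unfold cis; rewrite cos_0, sin_0; reflexivity. Qed.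

Lemma Cmod_cis (t : R) : Cmod (cis t) = 1.
Proof.
  assert (H := Cmod_sqr (cis t)); assert (H' := Cmod_ge_0 (cis t)).
  generalize (sin2_cos2 t); unfold Rsqr; simpl in *; nra.
Qed.

Lemma cis_2PI (t : R) : cis (t + 2 * PI) = cis t.
Proof. unfold cis; now rewrite cos_plus, sin_plus, cos_2PI, sin_2PI, !Rmult_1_r, !Rmult_0_r, Rminus_0_r, Rplus_0_r. Qed.

Lemma polar_form (z : C) : exists th : R, z = (RtoC (Cmod z) * cis th)%C.
Proof.
  destruct (Req_dec (Cmod z) 0) as [Hz|Hz].
  - exists 0. rewrite Hz. apply Cmod_eq_0 in Hz. rewrite Hz. ring.
  - assert (H := Cmod_sqr z); assert (H0 := Cmod_ge_0 z).
    set (m := Cmod z) in *; set (x := fst z / m); set (y := snd z / m).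
    assert (Hxy : x * x + y * y = 1).
    { unfold x, y. field_simplify; [|lra].
      apply (Rmult_eq_reg_r (m ^ 2)); [|nra]. field_simplify; [nra|lra]. }
    assert (Hx : -1 <= x <= 1) by nra.
    assert (Hfx : fst z = m * x) by (unfold x; field; lra).
    assert (Hfy : snd z = m * y) by (unfold y; field; lra).
    assert (Hs : sin (acos x) = Rabs y).
    { rewrite sin_acos by lra. rewrite <- sqrt_Rsqr_abs. f_equal. unfold Rsqr; nra. }
    destruct (Rle_dec 0 y) as [Hy|Hy].
    + exists (acos x). apply injective_projections; unfold cis; simpl.
      * rewrite cos_acos by lra. lra.
      * rewrite Hs, Rabs_pos_eq by lra. lra.
    + exists (- acos x). apply injective_projections; unfold cis; simpl.
      * rewrite cos_neg, cos_acos by lra. lra.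
      * rewrite sin_neg, Hs, Rabs_left by lra. lra.
Qed.

(** Componentwise, to match the componentwise integral [cint] and to reuse the calculus of real
    functions. *)
Definition ccont_at (f : R -> C) (t : R) : Prop :=
  continuous (fun x => fst (f x)) t /\ continuous (fun x => snd (f x)) t.

Lemma ccont_const (c : C) t : ccont_at (fun _ => c) t.
Proof. split; apply continuous_const. Qed.

Lemma ccont_plus f g t : ccont_at f t -> ccont_at g t -> ccont_at (fun x => f x + g x)%C t.
Proof.
  intros [Hf1 Hf2] [Hg1 Hg2]; split.
  - exact (continuous_plus _ _ _ Hf1 Hg1).
  - exact (continuous_plus _ _ _ Hf2 Hg2).
Qed.

Lemma ccont_opp f t : ccont_at f t -> ccont_at (fun x => - f x)%C t.
Proof.
  intros [Hf1 Hf2]; split.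
  - exact (continuous_opp _ _ Hf1).
  - exact (continuous_opp _ _ Hf2).
Qed.

Lemma ccont_minus f g t : ccont_at f t -> ccont_at g t -> ccont_at (fun x => f x - g x)%C t.
Proof. intros Hf Hg; apply ccont_plus; [exact Hf|apply ccont_opp, Hg]. Qed.

Lemma ccont_mult f g t : ccont_at f t -> ccont_at g t -> ccont_at (fun x => f x * g x)%C t.
Proof.
  intros [Hf1 Hf2] [Hg1 Hg2]; split.
  - exact (continuous_minus _ _ _ (continuous_mult _ _ _ Hf1 Hg1) (continuous_mult _ _ _ Hf2 Hg2)).
  - exact (continuous_plus _ _ _ (continuous_mult _ _ _ Hf1 Hg2) (continuous_mult _ _ _ Hf2 Hg1)).
Qed.

Lemma ccont_RtoC (f : R -> R) t : continuous f t -> ccont_at (fun x => RtoC (f x)) t.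
Proof. intros Hf; split; [exact Hf|apply continuous_const]. Qed.

Lemma ccont_id t : ccont_at RtoC t.
Proof. apply (ccont_RtoC (fun x => x)), continuous_id. Qed.

Lemma continuous_norm_sqr f t : ccont_at f t -> continuous (fun x => fst (f x) ^ 2 + snd (f x) ^ 2) t.
Proof.
  intros [H1 H2].
  apply (continuous_ext (fun x => plus (mult (fst (f x)) (fst (f x))) (mult (snd (f x)) (snd (f x))))).
  - intros x. unfold plus, mult; simpl. ring.
  - exact (continuous_plus _ _ _ (continuous_mult _ _ _ H1 H1) (continuous_mult _ _ _ H2 H2)).
Qed.

Lemma ccont_inv f t : ccont_at f t -> f t <> RtoC 0 -> ccont_at (fun x => / f x)%C t.
Proof.
  intros Hf Hn. assert (Hf' := Hf). destruct Hf' as [Hf1 Hf2].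
  assert (Hd : continuous (fun x => / (fst (f x) ^ 2 + snd (f x) ^ 2)) t).
  { apply (continuous_comp (fun x => fst (f x) ^ 2 + snd (f x) ^ 2) Rinv).
    - now apply continuous_norm_sqr.
    - apply continuous_Rinv. intros H0. apply Hn, Cmod_eq_0.
      generalize (Cmod_sqr (f t)). nra. }
  split.
  - exact (continuous_mult _ _ _ Hf1 Hd).
  - exact (continuous_mult _ _ _ (continuous_opp _ _ Hf2) Hd).
Qed.

Lemma ccont_comp (f : R -> C) (u : R -> R) t : continuous u t -> ccont_at f (u t) -> ccont_at (fun x => f (u x)) t.
Proof.
  intros Hu [H1 H2]; split.
  - exact (continuous_comp u (fun x => fst (f x)) t Hu H1).
  - exact (continuous_comp u (fun x => snd (f x)) t Hu H2).
Qed.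

Lemma ccont_cis t : ccont_at cis t.
Proof. split; [apply continuous_cos|apply continuous_sin]. Qed.

Lemma ccont_eps (f : R -> C) t :
  (forall e, 0 < e -> exists d, 0 < d /\ forall x, Rabs (x - t) < d -> Cmod (f x - f t) < e) ->
  ccont_at f t.
Proof.
  intros H; split; apply continuity_pt_filterlim; intros e He;
    destruct (H e He) as [d [Hd Hd']]; exists d; split; [exact Hd| |exact Hd|];
    intros x [_ Hx]; simpl in *; unfold R_dist in *.
  - eapply Rle_lt_trans; [|apply (Hd' x Hx)]. apply (Cmod_fst (f x - f t)).
  - eapply Rle_lt_trans; [|apply (Hd' x Hx)]. apply (Cmod_snd (f x - f t)).
Qed.

Definition cint (f : R -> C) (a b : R) : C :=
  (RInt (fun t => fst (f t)) a b, RInt (fun t => snd (f t)) a b).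

Definition cex (f : R -> C) (a b : R) : Prop :=
  ex_RInt (fun t => fst (f t)) a b /\ ex_RInt (fun t => snd (f t)) a b.

Lemma cex_cont f a b : (forall t, Rmin a b <= t <= Rmax a b -> ccont_at f t) -> cex f a b.
Proof. intros H; split; apply (ex_RInt_continuous (V := R_CompleteNormedModule)); intros t Ht; apply (H t Ht). Qed.

Lemma cex_cont_all f a b : (forall t, ccont_at f t) -> cex f a b.
Proof. intros H; apply cex_cont; auto. Qed.

Lemma cint_plus f g a b : cex f a b -> cex g a b ->
  cint (fun t => f t + g t)%C a b = (cint f a b + cint g a b)%C.
Proof.
  intros [Hf1 Hf2] [Hg1 Hg2]; apply injective_projections.
  - exact (RInt_plus _ _ _ _ Hf1 Hg1).
  - exact (RInt_plus _ _ _ _ Hf2 Hg2).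
Qed.

Lemma cex_plus f g a b : cex f a b -> cex g a b -> cex (fun t => f t + g t)%C a b.
Proof.
  intros [Hf1 Hf2] [Hg1 Hg2]; split.
  - exact (ex_RInt_plus _ _ _ _ Hf1 Hg1).
  - exact (ex_RInt_plus _ _ _ _ Hf2 Hg2).
Qed.

Lemma cex_scal c f a b : cex f a b -> cex (fun t => c * f t)%C a b.
Proof.
  intros [H1 H2]; split.
  - exact (ex_RInt_minus _ _ _ _ (ex_RInt_scal _ _ _ (fst c) H1) (ex_RInt_scal _ _ _ (snd c) H2)).
  - exact (ex_RInt_plus _ _ _ _ (ex_RInt_scal _ _ _ (fst c) H2) (ex_RInt_scal _ _ _ (snd c) H1)).
Qed.

Lemma cint_scal c f a b : cex f a b -> cint (fun t => c * f t)%C a b = (c * cint f a b)%C.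
Proof.
  intros [H1 H2]; apply injective_projections; unfold cint; simpl.
  - etransitivity; [exact (RInt_minus _ _ _ _ (ex_RInt_scal _ _ _ (fst c) H1) (ex_RInt_scal _ _ _ (snd c) H2))|].
    exact (f_equal2 Rminus (RInt_scal _ _ _ (fst c) H1) (RInt_scal _ _ _ (snd c) H2)).
  - etransitivity; [exact (RInt_plus _ _ _ _ (ex_RInt_scal _ _ _ (fst c) H2) (ex_RInt_scal _ _ _ (snd c) H1))|].
    exact (f_equal2 Rplus (RInt_scal _ _ _ (fst c) H2) (RInt_scal _ _ _ (snd c) H1)).
Qed.

Lemma cint_ext f g a b : (forall t, f t = g t) -> cint f a b = cint g a b.
Proof. intros H; unfold cint; f_equal; apply RInt_ext; intros t _; now rewrite H. Qed.

Lemma cint_minus f g a b : cex f a b -> cex g a b ->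
  cint (fun t => f t - g t)%C a b = (cint f a b - cint g a b)%C.
Proof.
  intros [Hf1 Hf2] [Hg1 Hg2]; apply injective_projections.
  - exact (RInt_minus _ _ _ _ Hf1 Hg1).
  - exact (RInt_minus _ _ _ _ Hf2 Hg2).
Qed.

Lemma cint_const c a b : cint (fun _ => c) a b = (RtoC (b - a) * c)%C.
Proof.
  unfold cint; rewrite !RInt_const; apply injective_projections; simpl; unfold scal; simpl; unfold mult; simpl; ring.
Qed.

Lemma cint_Chasles f a b c : cex f a b -> cex f b c -> (cint f a b + cint f b c)%C = cint f a c.
Proof.
  intros [H1 H2] [H3 H4]; apply injective_projections.
  - exact (RInt_Chasles _ _ _ _ H1 H3).
  - exact (RInt_Chasles _ _ _ _ H2 H4).
Qed.

Lemma cint_shift f v a b : cex f (a + v) (b + v) ->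
  cint (fun t => f (t + v)) a b = cint f (a + v) (b + v).
Proof.
  intros [H1 H2]; unfold cint; f_equal.
  - etransitivity; [|etransitivity; [apply (RInt_comp_lin (fun t => fst (f t)) 1 v a b)|]];
      rewrite ?Rmult_1_l; try assumption; try reflexivity.
    apply RInt_ext; intros x _; replace (1 * x + v) with (x + v) by ring; symmetry; apply (Rmult_1_l (fst (f (x + v)))).
  - etransitivity; [|etransitivity; [apply (RInt_comp_lin (fun t => snd (f t)) 1 v a b)|]];
      rewrite ?Rmult_1_l; try assumption; try reflexivity.
    apply RInt_ext; intros x _; replace (1 * x + v) with (x + v) by ring; symmetry; apply (Rmult_1_l (snd (f (x + v)))).
Qed.

(** Bounding the two components separately would lose a factor. The pair is treated instead as one
    integral in the product normed module, whose norm is [Cmod]. *)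
Lemma cint_norm_le f (g : R -> R) a b : a <= b -> cex f a b -> ex_RInt g a b ->
  (forall t, a <= t <= b -> Cmod (f t) <= g t) -> Cmod (cint f a b) <= RInt g a b.
Proof.
  intros Hab [H1 H2] Hg Hle.
  rewrite Cmod_norm.
  apply (norm_RInt_le (V := prod_NormedModule R_AbsRing R_NormedModule R_NormedModule)
    f g a b (cint f a b) (RInt g a b) Hab).
  - intros t Ht. rewrite <- (Cmod_norm (f t)). auto.
  - apply (is_RInt_fct_extend_pair (U := R_NormedModule) (V := R_NormedModule) f).
    + exact (RInt_correct _ _ _ H1).
    + exact (RInt_correct _ _ _ H2).
  - exact (RInt_correct _ _ _ Hg).
Qed.

Lemma cint_norm_le_const f M a b : a <= b -> cex f a b ->
  (forall t, a <= t <= b -> Cmod (f t) <= M) -> Cmod (cint f a b) <= (b - a) * M.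
Proof.
  intros Hab Hf HM.
  assert (H : RInt (fun _ => M) a b = (b - a) * M) by (rewrite RInt_const; reflexivity).
  rewrite <- H. apply cint_norm_le; auto. apply ex_RInt_const.
Qed.

(** Cut at 0 and 2 pi. The piece from 2 pi to a + 2 pi is a translate of the piece from 0 to a,
    which cancels the one from a to 0. The sign of [a] is immaterial since the integrals are
    oriented. *)
Lemma cint_periodic f a : (forall t, ccont_at f t) -> (forall t, f (t + 2 * PI) = f t) ->
  cint f a (a + 2 * PI) = cint f 0 (2 * PI).
Proof.
  intros Hc Hp.
  assert (He : forall x y, cex f x y) by (intros; now apply cex_cont_all).
  rewrite <- (cint_Chasles f a 0 (a + 2 * PI)) by auto.
  rewrite <- (cint_Chasles f 0 (2 * PI) (a + 2 * PI)) by auto.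
  assert (H : cint f (2 * PI) (a + 2 * PI) = cint f 0 a).
  { rewrite <- (cint_ext (fun t => f (t + 2 * PI)) f 0 a Hp).
    rewrite cint_shift by auto. now rewrite Rplus_0_l. }
  rewrite H.
  replace (cint f a 0 + (cint f 0 (2 * PI) + cint f 0 a))%C
    with ((cint f a 0 + cint f 0 a) + cint f 0 (2 * PI))%C by ring.
  rewrite cint_Chasles by auto.
  replace (cint f a a) with (RtoC 0); [ring|].
  unfold cint; rewrite !RInt_point; reflexivity.
Qed.

Lemma cint_deriv (f df : R -> C) a b :
  (forall t, Rmin a b <= t <= Rmax a b ->
     is_derive (fun x => fst (f x)) t (fst (df t)) /\ is_derive (fun x => snd (f x)) t (snd (df t))) ->
  (forall t, Rmin a b <= t <= Rmax a b -> ccont_at df t) ->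
  cint df a b = (f b - f a)%C.
Proof.
  intros Hd Hc; apply injective_projections; unfold cint; simpl;
  apply is_RInt_unique.
  - apply (is_RInt_derive (fun x => fst (f x)) (fun x => fst (df x))); intros t Ht; [apply Hd|apply Hc]; exact Ht.
  - apply (is_RInt_derive (fun x => snd (f x)) (fun x => snd (df x))); intros t Ht; [apply Hd|apply Hc]; exact Ht.
Qed.

(** * The Cauchy kernel on the unit circle *)

Lemma RInt_abs_le (f g : R -> R) a b : a <= b -> ex_RInt f a b -> ex_RInt g a b ->
  (forall t, a <= t <= b -> Rabs (f t) <= g t) -> Rabs (RInt f a b) <= RInt g a b.
Proof.
  intros Hab Hf Hg Hle.
  apply (norm_RInt_le (V := R_NormedModule) f g a b _ _ Hab Hle); apply (RInt_correct (V := R_CompleteNormedModule)); assumption.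
Qed.

Lemma ex_RInt_cont (f : R -> R) a b : (forall t, continuous f t) -> ex_RInt f a b.
Proof. intros H; apply (ex_RInt_continuous (V := R_CompleteNormedModule)); auto. Qed.

Lemma RInt_periodic (f : R -> R) a : (forall t, continuous f t) -> (forall t, f (t + 2 * PI) = f t) ->
  RInt f a (a + 2 * PI) = RInt f 0 (2 * PI).
Proof.
  intros Hc Hp.
  exact (f_equal fst (cint_periodic (fun t => RtoC (f t)) a (fun t => ccont_RtoC f t (Hc t))
           (fun t => f_equal RtoC (Hp t)))).
Qed.

Lemma continuous_Cmod (f : R -> C) t : ccont_at f t -> continuous (fun x => Cmod (f x)) t.
Proof.
  intros H. unfold Cmod.
  apply (continuous_comp (fun x => fst (f x) ^ 2 + snd (f x) ^ 2) sqrt);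
    [now apply continuous_norm_sqr|apply continuous_sqrt].
Qed.

(** With zeta = [cis t] this is zeta / (zeta - z), so [2 * kern z t - 1] is the Schwarz kernel (zeta
    + z) / (zeta - z). *)
Definition kern (z : C) (t : R) : C := (/ (1 - z * cis (- t)))%C.

Lemma cis_neg_cont t : ccont_at (fun t => cis (- t)) t.
Proof.
  apply (ccont_comp cis Ropp); [apply (continuous_opp (fun x : R => x)), continuous_id|apply ccont_cis].
Qed.

Lemma kern_denom_cont z t : ccont_at (fun t => 1 - z * cis (- t))%C t.
Proof. apply ccont_minus; [apply ccont_const|apply ccont_mult; [apply ccont_const|apply cis_neg_cont]]. Qed.

Lemma Cmod_mult_cis z t : Cmod (z * cis t) = Cmod z.
Proof. rewrite Cmod_mult, Cmod_cis; ring. Qed.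

Lemma kern_denom_ge z t : 1 - Cmod z <= Cmod (1 - z * cis (- t)).
Proof.
  generalize (Cmod_le_plus_minus (RtoC 1) (z * cis (- t))%C).
  rewrite Cmod_mult_cis, Cmod_1; lra.
Qed.

Lemma kern_denom_neq z t : Cmod z < 1 -> (1 - z * cis (- t))%C <> RtoC 0.
Proof. intros Hz; apply Cmod_neq_0; generalize (kern_denom_ge z t); lra. Qed.

Lemma kern_cont z t : Cmod z < 1 -> ccont_at (kern z) t.
Proof.
  intros Hz. apply (ccont_inv (fun t => 1 - z * cis (- t))%C);
    [apply kern_denom_cont|now apply kern_denom_neq].
Qed.

Lemma kern_Cmod z t : Cmod z < 1 -> Cmod (kern z t) = / Cmod (1 - z * cis (- t)).
Proof. intros Hz; apply Cmod_inv; now apply kern_denom_neq. Qed.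

Lemma kern_Cmod_le z t r : Cmod z <= r -> r < 1 -> Cmod (kern z t) <= / (1 - r).
Proof.
  intros Hz Hr; rewrite kern_Cmod by lra; apply Rinv_le_contravar; [lra|].
  generalize (kern_denom_ge z t); lra.
Qed.

Lemma kern_periodic z t : kern z (t + 2 * PI) = kern z t.
Proof.
  unfold kern; do 3 f_equal.
  rewrite <- (cis_2PI (- (t + 2 * PI))); f_equal; ring.
Qed.

Lemma cis_INR (n : nat) (x : R) : cis (INR n * x) = (cis x ^ n)%C.
Proof.
  induction n as [|n IH].
  - simpl; rewrite Rmult_0_l; apply cis_0.
  - rewrite S_INR. simpl Cpow. rewrite <- IH, <- cis_plus. f_equal; ring.
Qed.

Lemma cis_INR_2PI (n : nat) : cis (INR n * (2 * PI)) = RtoC 1.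
Proof.
  rewrite cis_INR.
  replace (cis (2 * PI)) with (RtoC 1).
  - induction n as [|n IH]; simpl; [reflexivity|rewrite IH; ring].
  - rewrite <- cis_0, <- (cis_2PI 0); f_equal; ring.
Qed.

Lemma cint_cis_INR (n : nat) : cint (fun t => cis (- (INR (S n) * t))) 0 (2 * PI) = RtoC 0.
Proof.
  set (m := INR (S n)).
  assert (Hm : m <> 0) by (unfold m; apply not_0_INR; lia).
  (* The primitive is i e^{-imt} / m, written in components; it takes the same value at 0 and 2
     pi. *)
  rewrite (cint_deriv (fun t => (sin (m * t) / m, cos (m * t) / m))).
  - assert (H := cis_INR_2PI (S n)); fold m in H; unfold cis in H; injection H as H1 H2.
    apply injective_projections; simpl; rewrite ?H1, ?H2, Rmult_0_r, ?sin_0, ?cos_0; field; auto.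
  - intros t _; simpl; split; auto_derive; auto; rewrite ?cos_neg, ?sin_neg; field; auto.
  - intros t _. apply (ccont_comp cis (fun t => - (m * t))); [|apply ccont_cis].
    apply (continuous_opp (fun t : R => m * t)), (continuous_scal_r (V := R_NormedModule) m), continuous_id.
Qed.

Lemma kern_pow_cont z k t : ccont_at (fun t => ((z * cis (- t)) ^ k)%C) t.
Proof.
  induction k as [|k IH]; simpl; [apply ccont_const|].
  apply ccont_mult; [apply ccont_mult; [apply ccont_const|apply cis_neg_cont]|exact IH].
Qed.

(** With u = [z * cis (- t)], u^(k+1) / (1 - u) = u^k / (1 - u) - u^k, and u^k has integral 0 for k
    >= 1. *)
Lemma cint_kern_pow z n : Cmod z < 1 ->
  cint (fun t => (z * cis (- t)) ^ S n * kern z t)%C 0 (2 * PI) =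
  cint (fun t => z * cis (- t) * kern z t)%C 0 (2 * PI).
Proof.
  intros Hz.
  induction n as [|n IH].
  - apply cint_ext; intros t; simpl; ring.
  - rewrite <- IH.
    rewrite (cint_ext _ (fun t => (z * cis (- t)) ^ S n * kern z t - z ^ S n * cis (- (INR (S n) * t)))%C).
    + rewrite cint_minus, cint_scal, cint_cis_INR; [ring| | |];
        apply cex_cont_all; intros t.
      * apply (ccont_comp cis (fun t => - (INR (S n) * t))); [|apply ccont_cis].
        apply (continuous_opp (fun t : R => INR (S n) * t)), (continuous_scal_r (V := R_NormedModule) (INR (S n))), continuous_id.
      * apply ccont_mult; [apply kern_pow_cont|now apply kern_cont].
      * apply ccont_mult; [apply ccont_const|].
        apply (ccont_comp cis (fun t => - (INR (S n) * t))); [|apply ccont_cis].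
        apply (continuous_opp (fun t : R => INR (S n) * t)), (continuous_scal_r (V := R_NormedModule) (INR (S n))), continuous_id.
    + intros t.
      replace (- (INR (S n) * t)) with (INR (S n) * - t) by ring.
      rewrite cis_INR, <- Cpow_mult_l.
      set (p := ((z * cis (- t)) ^ S n)%C).
      change ((z * cis (- t)) ^ S (S n))%C with ((z * cis (- t)) * p)%C.
      unfold kern; field. now apply kern_denom_neq.
Qed.

(* Cauchy's formula for the constant 1. The integrals of [u^n / (1 - u)], [u = z cis (- t)], do not
   depend on [n >= 1] and are bounded by a multiple of [|z|^n], so they vanish. *)
Lemma cint_kern z : Cmod z < 1 -> cint (kern z) 0 (2 * PI) = RtoC (2 * PI).
Proof.
  intros Hz. assert (HPI := PI_RGT_0).
  set (J := cint (fun t => z * cis (- t) * kern z t)%C 0 (2 * PI)).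
  assert (HJ : J = RtoC 0).
  { apply Cmod_eq_0.
    assert (Hb : forall n, Cmod J <= 2 * PI * / (1 - Cmod z) * Cmod z ^ n).
    { intros n. unfold J; rewrite <- (cint_kern_pow z n Hz).
      eapply Rle_trans; [apply (cint_norm_le_const _ (Cmod z ^ n * / (1 - Cmod z)))|right; ring].
      - lra.
      - apply cex_cont_all; intros t; apply ccont_mult; [apply kern_pow_cont|now apply kern_cont].
      - intros t _. rewrite Cmod_mult, Cmod_pow, Cmod_mult_cis.
        assert (H0 := Cmod_ge_0 z).
        apply Rmult_le_compat; [apply pow_le; exact H0|apply Cmod_ge_0| |apply kern_Cmod_le; lra].
        simpl. assert (0 <= Cmod z ^ n) by (apply pow_le; exact H0). nra. }
    apply Rle_antisym; [|apply Cmod_ge_0].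
    assert (Hlim : is_lim_seq (fun n => 2 * PI * / (1 - Cmod z) * Cmod z ^ n) 0).
    { replace 0 with (2 * PI * / (1 - Cmod z) * 0) by ring.
      apply (is_lim_seq_scal_l _ _ 0), is_lim_seq_geom. rewrite Rabs_pos_eq; [exact Hz|apply Cmod_ge_0]. }
    exact (is_lim_seq_le (fun _ => Cmod J) _ (Cmod J) 0 Hb (is_lim_seq_const _) Hlim). }
  rewrite (cint_ext (kern z) (fun t => RtoC 1 + z * cis (- t) * kern z t)%C).
  - rewrite cint_plus, cint_const; fold J; [rewrite HJ; apply injective_projections; simpl; ring| |].
    + apply cex_cont_all; intros; apply ccont_const.
    + apply cex_cont_all; intros t; apply ccont_mult; [|now apply kern_cont].
      apply ccont_mult; [apply ccont_const|apply cis_neg_cont].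
  - intros t; unfold kern; field; now apply kern_denom_neq.
Qed.

(** The resolvent identity. Applied once it gives the increments of the Schwarz integral, applied
    twice its second-order remainder. *)
Lemma kern_diff z w t : Cmod z < 1 -> Cmod w < 1 ->
  (kern z t - kern w t = (z - w) * (kern z t * kern w t * cis (- t)))%C.
Proof. intros Hz Hw; unfold kern; field; split; now apply kern_denom_neq. Qed.

Ltac ccont :=
  match goal with
  | |- ccont_at (fun _ => ?c) ?t => apply (ccont_const c t)
  | |- ccont_at (fun x => Cmult (@?f x) (@?g x)) ?t => apply (ccont_mult f g t); ccont
  | |- ccont_at (fun x => Cminus (@?f x) (@?g x)) ?t => apply (ccont_minus f g t); ccont
  | |- ccont_at (fun x => cis (- x)) ?t => apply (cis_neg_cont t)
  | |- ccont_at (fun x => kern ?z x) ?t => apply (kern_cont z t); assumption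
  | |- ccont_at (kern ?z) ?t => apply (kern_cont z t); assumption
  | |- ccont_at (fun x => RtoC (@?f x)) ?t => apply (ccont_RtoC f t); auto
  end.

(** Multiplied by z - w, the integral is by [kern_diff] the difference of two integrals both equal
    to 2 pi. It is what permits subtracting a constant from [rho] in [schwarz_increment]. *)
Lemma cint_kern_kern z w : Cmod z < 1 -> Cmod w < 1 -> z <> w ->
  cint (fun t => kern z t * kern w t * cis (- t))%C 0 (2 * PI) = RtoC 0.
Proof.
  intros Hz Hw Hn.
  assert (H : ((z - w) * cint (fun t => kern z t * kern w t * cis (- t)) 0 (2 * PI))%C = RtoC 0).
  { rewrite <- cint_scal by (apply cex_cont_all; intros; ccont).
    rewrite <- (cint_ext _ _ _ _ (fun t => kern_diff z w t Hz Hw)).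
    rewrite (cint_minus (kern z) (kern w)) by (apply cex_cont_all; intros; ccont).
    rewrite !cint_kern by assumption. ring. }
  destruct (Ceq_dec (cint (fun t => kern z t * kern w t * cis (- t)) 0 (2 * PI))%C (RtoC 0)) as [E|E]; [exact E|].
  exfalso. refine (Cmult_neq_0 _ _ _ E H).
  intros E0. apply Hn. replace z with (z - w + w)%C by ring. rewrite E0; ring.
Qed.

(** * Elementary trigonometric inequalities and the distance to a boundary point *)

Lemma mono_from_0 (f df : R -> R) (b : R) :
  (forall x, is_derive f x (df x)) -> f 0 = 0 -> (forall x, 0 <= x <= b -> 0 <= df x) ->
  forall x, 0 <= x <= b -> 0 <= f x.
Proof.
  intros Hd H0 Hp x Hx.
  destruct (MVT_gen f 0 x df) as [c [Hc E]].
  - intros; apply Hd.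
  - intros y _. apply continuity_pt_filterlim, (ex_derive_continuous (V := R_NormedModule)). exists (df y); apply Hd.
  - rewrite Rmin_left, Rmax_right in Hc by lra. rewrite H0 in E.
    assert (0 <= df c) by (apply Hp; lra). nra.
Qed.

Lemma x_cos_le_sin v : 0 <= v <= PI -> 0 <= sin v - v * cos v.
Proof.
  apply (mono_from_0 (fun v => sin v - v * cos v) (fun v => v * sin v)).
  - intros x; auto_derive; auto; ring.
  - rewrite sin_0; ring.
  - intros x Hx; apply Rmult_le_pos; [lra|apply sin_ge_0; lra].
Qed.

(** This is v cot v <= 1 - v^2/3, the first two terms of its expansion, multiplied by sin v. The
    derivative of the difference is (v/3)(sin v - v cos v), nonnegative by [x_cos_le_sin]. The
    quadratic term is the source of the gain pi^2/18. *)
Lemma x_cot_le v : 0 <= v <= PI -> v * cos v <= (1 - v ^ 2 / 3) * sin v.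
Proof.
  intros Hv.
  enough (0 <= (1 - v ^ 2 / 3) * sin v - v * cos v) by lra.
  revert v Hv.
  apply (mono_from_0 (fun v => (1 - v ^ 2 / 3) * sin v - v * cos v) (fun v => v / 3 * (sin v - v * cos v))).
  - intros x; auto_derive; auto; field.
  - rewrite sin_0; ring.
  - intros x Hx; apply Rmult_le_pos; [lra|apply x_cos_le_sin; lra].
Qed.

(** From sin v >= v - v^3/6 and v <= 2. The constant 1/3 is not sharp; it only affects the constants
    of the Hoelder bound. *)
Lemma sin_ge_third v : 0 <= v <= PI / 2 -> v / 3 <= sin v.
Proof.
  intros Hv.
  assert (HP := PI_4).
  assert (H : 0 <= sin v - v + v ^ 3 / 6).
  { revert v Hv. apply (mono_from_0 (fun v => sin v - v + v ^ 3 / 6) (fun v => cos v - 1 + v ^ 2 / 2)).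
    - intros x; auto_derive; auto; field.
    - rewrite sin_0; field.
    - apply (mono_from_0 (fun v => cos v - 1 + v ^ 2 / 2) (fun v => v - sin v)).
      + intros x; auto_derive; auto; field.
      + rewrite cos_0; field.
      + intros x Hx. destruct (Req_dec x 0) as [->|E]; [rewrite sin_0; lra|].
        generalize (sin_lt_x x ltac:(lra)); lra. }
  assert (v ^ 2 <= 4) by nra. simpl in *. nra.
Qed.

Lemma Cmod_denom_sqr (r u : R) : Cmod (1 - r * cis (- u)) ^ 2 = (1 - r) ^ 2 + 4 * r * sin (u / 2) ^ 2.
Proof.
  rewrite Cmod2_alt. unfold cis, Re, Im; simpl. rewrite cos_neg, sin_neg.
  assert (Hc : cos u = 1 - 2 * sin (u / 2) * sin (u / 2)).
  { replace u with (2 * (u / 2)) at 1 by field. apply cos_2a_sin. }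
  assert (Hs := sin2_cos2 u). unfold Rsqr in Hs.
  transitivity (1 - 2 * r * cos u + r * r * (sin u * sin u + cos u * cos u)); [ring|].
  rewrite Hs, Hc; ring.
Qed.

(** The modulus dominates |sin (u/2)|, which is at least |u|/6 by [sin_ge_third]. The constant does
    not depend on r, so the estimate survives as r tends to 1. *)
Lemma Cmod_denom_lower (r u : R) : 0 <= r < 1 -> Rabs u <= PI ->
  Rabs u <= 6 * Cmod (1 - r * cis (- u)).
Proof.
  intros Hr Hu.
  assert (Hs : Rabs u / 6 <= Rabs (sin (u / 2))).
  { destruct (Rle_dec 0 u) as [H|H].
    - rewrite Rabs_pos_eq in * by lra. rewrite Rabs_pos_eq; [|apply sin_ge_0; lra].
      generalize (sin_ge_third (u / 2) ltac:(lra)); lra.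
    - rewrite Rabs_left in Hu |- * by lra.
      replace (u / 2) with (- (- u / 2)) by field. rewrite sin_neg, Rabs_Ropp.
      rewrite Rabs_pos_eq; [|apply sin_ge_0; lra].
      generalize (sin_ge_third (- u / 2) ltac:(lra)); lra. }
  assert (H := Cmod_denom_sqr r u). assert (H0 := Cmod_ge_0 (1 - r * cis (- u))).
  set (m := Cmod (1 - r * cis (- u))) in *.
  assert (Hs2 : sin (u / 2) ^ 2 <= 1).
  { generalize (sin2_cos2 (u / 2)); unfold Rsqr; nra. }
  assert (Hm : Rabs (sin (u / 2)) <= m).
  { apply Rsqr_incr_0; [|apply Rabs_pos|exact H0]. rewrite <- Rsqr_abs. unfold Rsqr. 
    set (q := sin (u / 2) ^ 2) in *.
    assert (Hq : 0 <= q) by (unfold q; apply pow2_ge_0).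
    (* The decomposition used is (1-r)^2 + 4rq - q = (1-q)(1-r)^2 + q(r^2 + 2r). *)
    assert (A : 0 <= (1 - q) * (1 - r) ^ 2) by (apply Rmult_le_pos; [lra|apply pow2_ge_0]).
    assert (B : 0 <= q * (r * r + 2 * r)) by (apply Rmult_le_pos; nra).
    replace (sin (u / 2) * sin (u / 2)) with q by (unfold q; ring).
    simpl in H, A. lra. }
  lra.
Qed.

Lemma kern_polar (r th t : R) : kern (RtoC r * cis th) t = (/ (1 - r * cis (- (t - th))))%C.
Proof.
  unfold kern. do 2 f_equal. rewrite <- Cmult_assoc, <- cis_plus. do 2 f_equal; ring.
Qed.

Lemma denom_polar (r th t : R) : (1 - RtoC r * cis th * cis (- t) = 1 - r * cis (- (t - th)))%C.
Proof. rewrite <- Cmult_assoc, <- cis_plus. do 3 f_equal; ring. Qed.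

Lemma RInt_inv_abs d : 0 < d ->
  ex_RInt (fun x => / (d + Rabs x)) (- PI) PI /\
  RInt (fun x => / (d + Rabs x)) (- PI) PI = 2 * ln ((d + PI) / d).
Proof.
  intros Hd. assert (HPI := PI_RGT_0).
  assert (H1 : is_RInt (fun x => / (d + Rabs x)) 0 PI (ln ((d + PI) / d))).
  { replace (ln ((d + PI) / d)) with (minus (ln (d + PI)) (ln (d + 0))).
    2:{ unfold minus, plus, opp; simpl. rewrite Rplus_0_r, ln_div by lra. reflexivity. }
    apply (is_RInt_ext (fun x => / (d + x))).
    { intros x Hx. rewrite Rmin_left, Rmax_right in Hx by lra. rewrite Rabs_pos_eq; lra. }
    apply (is_RInt_derive (fun x => ln (d + x))); intros x Hx; rewrite Rmin_left, Rmax_right in Hx by lra.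
    - auto_derive; [lra|field; lra].
    - apply continuous_Rinv_comp; [|lra].
      apply (continuous_plus (V := R_NormedModule)); [apply continuous_const|apply continuous_id]. }
  assert (H2 : is_RInt (fun x => / (d + Rabs x)) (- PI) 0 (ln ((d + PI) / d))).
  { replace (ln ((d + PI) / d)) with (minus (- ln (d - 0)) (- ln (d - - PI))).
    2:{ unfold minus, plus, opp; simpl. rewrite Rminus_0_r, ln_div by lra.
        replace (d - - PI) with (d + PI) by ring. ring. }
    apply (is_RInt_ext (fun x => / (d - x))).
    { intros x Hx. rewrite Rmin_left, Rmax_right in Hx by lra. rewrite Rabs_left; [f_equal; ring|lra]. }
    apply (is_RInt_derive (fun x => - ln (d - x))); intros x Hx; rewrite Rmin_left, Rmax_right in Hx by lra.
    - auto_derive; [lra|field; lra].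
    - apply continuous_Rinv_comp; [|lra].
      apply (continuous_minus (V := R_NormedModule)); [apply continuous_const|apply continuous_id]. }
  assert (H := is_RInt_Chasles _ _ _ _ _ _ H2 H1).
  split; [eexists; exact H|].
  refine (eq_trans (is_RInt_unique (V := R_CompleteNormedModule) _ _ _ _ H) _).
  change (ln ((d + PI) / d) + ln ((d + PI) / d) = 2 * ln ((d + PI) / d)). ring.
Qed.

Lemma RInt_shift_sym (g : R -> R) th : ex_RInt g (- PI) PI ->
  ex_RInt (fun t => g (t - th)) (th - PI) (th + PI) /\
  RInt (fun t => g (t - th)) (th - PI) (th + PI) = RInt g (- PI) PI.
Proof.
  intros [l Hl].
  assert (H : is_RInt (fun t => g (t - th)) (th - PI) (th + PI) l).
  { apply (is_RInt_ext (fun t => scal 1 (g (1 * t + - th)))).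
    - intros x _. unfold scal; simpl; unfold mult; simpl. rewrite !Rmult_1_l. reflexivity.
    - apply (is_RInt_comp_lin (V := R_NormedModule) g 1 (- th) (th - PI) (th + PI) l).
      replace (1 * (th - PI) + - th) with (- PI) by ring.
      replace (1 * (th + PI) + - th) with PI by ring. exact Hl. }
  split; [eexists; exact H|].
  exact (eq_trans (is_RInt_unique (V := R_CompleteNormedModule) _ _ _ _ H)
    (eq_sym (is_RInt_unique (V := R_CompleteNormedModule) _ _ _ _ Hl))).
Qed.

Definition kern_L1 (w : C) : R := RInt (fun t => Cmod (kern w t)) 0 (2 * PI).

(** Recentring the period at the argument of w keeps |t - th| <= pi, the range in which
    [Cmod_denom_lower] applies. *)
Lemma kern_L1_window w th : Cmod w < 1 ->
  RInt (fun t => Cmod (kern w t)) (th - PI) (th + PI) = kern_L1 w.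
Proof.
  intros Hw. replace (th + PI) with (th - PI + 2 * PI) by ring.
  apply RInt_periodic; intros t.
  - apply continuous_Cmod; now apply kern_cont.
  - now rewrite kern_periodic.
Qed.

(** The denominator m satisfies both m >= d and 6m >= |t - th|, hence 8m >= d + |t - th|. The
    integral of 1/(d + |x|) gives the logarithm. *)
Lemma kern_L1_le_ln w : Cmod w < 1 -> kern_L1 w <= 16 * ln ((1 - Cmod w + PI) / (1 - Cmod w)).
Proof.
  intros Hw. set (d := 1 - Cmod w). assert (Hd : 0 < d) by (unfold d; lra).
  assert (HPI := PI_RGT_0).
  destruct (polar_form w) as [th Hth]. assert (H0 := Cmod_ge_0 w).
  rewrite <- (kern_L1_window w th Hw).
  destruct (RInt_inv_abs d Hd) as [Hex Hv].
  destruct (RInt_shift_sym _ th Hex) as [Hex2 Hv2].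
  replace (16 * ln ((d + PI) / d)) with (8 * (2 * ln ((d + PI) / d))) by ring.
  rewrite <- Hv, <- Hv2.
  assert (Hsc := RInt_scal (V := R_CompleteNormedModule) _ _ _ 8 Hex2).
  change (RInt (fun t => 8 * / (d + Rabs (t - th))) (th - PI) (th + PI) =
    8 * RInt (fun t => / (d + Rabs (t - th))) (th - PI) (th + PI)) in Hsc.
  rewrite <- Hsc.
  apply RInt_le; [lra| |exact (ex_RInt_scal (V := R_NormedModule) _ _ _ 8 Hex2)|].
  - apply ex_RInt_cont; intros t; apply continuous_Cmod; now apply kern_cont.
  - intros t Ht. rewrite kern_Cmod by exact Hw.
    assert (Ha := kern_denom_ge w t). fold d in Ha.
    assert (Hb : Rabs (t - th) <= 6 * Cmod (1 - w * cis (- t))).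
    { rewrite Hth, denom_polar. apply Cmod_denom_lower; [lra|]. apply Rabs_le; lra. }
    assert (Hc := Rabs_pos (t - th)).
    set (m := Cmod (1 - w * cis (- t))) in *.
    replace (8 * / (d + Rabs (t - th))) with (/ ((d + Rabs (t - th)) / 8)) by (field; lra).
    apply Rinv_le_contravar; lra.
Qed.

Lemma kern_L1_nonneg w : Cmod w < 1 -> 0 <= kern_L1 w.
Proof.
  intros Hw. assert (HPI := PI_RGT_0).
  apply RInt_ge_0; [lra| |intros; apply Cmod_ge_0].
  apply ex_RInt_cont; intros t; apply continuous_Cmod; now apply kern_cont.
Qed.

(** The logarithm is traded for an arbitrarily small negative power through ln y <= y^beta / beta.
    This trade is the reason for excluding the exponent 1 later. *)
Lemma kern_L1_le beta : 0 < beta -> exists K, 0 < K /\ forall w, Cmod w < 1 ->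
  kern_L1 w <= K * Rpower (1 - Cmod w) (- beta).
Proof.
  intros Hb. assert (HPI := PI_RGT_0).
  exists (16 / beta * Rpower (1 + PI) beta).
  split.
  { apply Rmult_lt_0_compat; [apply Rdiv_lt_0_compat; lra|apply exp_pos]. }
  intros w Hw. eapply Rle_trans; [now apply kern_L1_le_ln|].
  set (d := 1 - Cmod w). assert (Hd : 0 < d <= 1) by (unfold d; generalize (Cmod_ge_0 w); lra).
  assert (Hx : 0 < (d + PI) / d) by (apply Rdiv_lt_0_compat; lra).
  assert (H1 : ln ((d + PI) / d) <= / beta * Rpower ((d + PI) / d) beta).
  { unfold Rpower. set (y := ln ((d + PI) / d)).
    generalize (exp_ineq1_le (beta * y)). intros H.
    apply (Rmult_le_reg_l beta); [lra|]. rewrite <- Rmult_assoc, Rinv_r by lra. lra. }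
  assert (H2 : Rpower ((d + PI) / d) beta <= Rpower (1 + PI) beta * Rpower d (- beta)).
  { rewrite Rpower_Ropp. unfold Rdiv. rewrite <- Rpower_mult_distr by (try apply Rinv_0_lt_compat; lra).
    replace (Rpower (/ d) beta) with (/ Rpower d beta).
    - apply Rmult_le_compat_r; [left; apply Rinv_0_lt_compat, exp_pos|]. apply Rle_Rpower_l; lra.
    - unfold Rpower. rewrite ln_Rinv by lra. rewrite <- exp_Ropp. f_equal; ring. }
  replace (16 / beta * Rpower (1 + PI) beta * Rpower d (- beta)) with (16 * (/ beta * (Rpower (1 + PI) beta * Rpower d (- beta)))) by (field; lra).
  apply Rmult_le_compat_l; [lra|]. eapply Rle_trans; [exact H1|].
  apply Rmult_le_compat_l; [left; apply Rinv_0_lt_compat; lra|exact H2].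
Qed.

(** * The Schwarz integral *)

Definition lip_periodic (rho : R -> R) : Prop :=
  (forall s t, Rabs (rho s - rho t) <= Rabs (s - t)) /\
  (forall t, rho (t + 2 * PI) = rho t).

Lemma lip_continuous rho t : (forall s t, Rabs (rho s - rho t) <= Rabs (s - t)) -> continuous rho t.
Proof.
  intros H. apply continuity_pt_filterlim; intros e He; exists e; split; [exact He|].
  intros x [_ Hx]; simpl in *; unfold R_dist in *. eapply Rle_lt_trans; [apply H|exact Hx].
Qed.

Lemma lip_periodic_bounded rho : lip_periodic rho ->
  exists M, 0 < M /\ forall t, 0 <= t <= 2 * PI -> Rabs (rho t) <= M.
Proof.
  intros [H _]. exists (Rabs (rho 0) + 2 * PI). assert (HPI := PI_RGT_0). split.
  - generalize (Rabs_pos (rho 0)); lra.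
  - intros t Ht. specialize (H t 0). rewrite Rminus_0_r, (Rabs_pos_eq t) in H by lra.
    generalize (Rabs_triang (rho 0) (rho t - rho 0)).
    replace (rho 0 + (rho t - rho 0)) with (rho t) by ring. lra.
Qed.

(** The normalisation makes the value at 0 the mean of [rho], a real number; the rotation of the
    final map is left to a separate unimodular factor. *)
Definition schwarz (rho : R -> R) (z : C) : C :=
  (RtoC (/ (2 * PI)) * cint (fun t => (2 * kern z t - 1) * RtoC (rho t)) 0 (2 * PI))%C.

Definition schwarz_deriv (rho : R -> R) (z : C) : C :=
  (RtoC (/ (2 * PI)) *
   cint (fun t => 2 * cis (- t) * (kern z t * kern z t) * RtoC (rho t)) 0 (2 * PI))%C.

(** The Schwarz kernel has mean 1 by [cint_kern], so constants reproduce themselves. In the window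
    centred at th the Lipschitz factor vanishes where the kernel is singular. *)
Lemma schwarz_sub_const rho th z : lip_periodic rho -> Cmod z < 1 ->
  (schwarz rho z - RtoC (rho th))%C =
  (RtoC (/ (2 * PI)) *
   cint (fun t => (2 * kern z t - 1) * RtoC (rho t - rho th)) (th - PI) (th + PI))%C.
Proof.
  intros [Hl Hp] Hz. assert (HPI := PI_RGT_0).
  assert (Hc : forall t, continuous rho t) by (intros; now apply lip_continuous).
  assert (Hc' : forall t, continuous (fun t => rho t - rho th) t).
  { intros t; apply (continuous_minus (V := R_NormedModule)); [apply Hc|apply continuous_const]. }
  replace (th + PI) with (th - PI + 2 * PI) by ring.
  rewrite cint_periodic; [|intros; ccont|intros t; now rewrite kern_periodic, Hp].
  rewrite (cint_ext (fun t => (2 * kern z t - 1) * RtoC (rho t - rho th))%C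
    (fun t => (2 * kern z t - 1) * RtoC (rho t) - RtoC (rho th) * (2 * kern z t - 1))%C).
  2:{ intros t. rewrite RtoC_minus. ring. }
  rewrite cint_minus, cint_scal, cint_minus, cint_scal, cint_kern, cint_const by
    (try exact Hz; apply cex_cont_all; intros; ccont).
  unfold schwarz. rewrite Rminus_0_r.
  replace (RtoC (/ (2 * PI))) with (/ RtoC (2 * PI))%C by (symmetry; apply RtoC_inv; lra).
  field. intros H; apply RtoC_inj in H; lra.
Qed.

(** By [kern_diff] the increment is (z - w)/pi times the integral of kern z, kern w, cis(-t) and
    rho(t); by [cint_kern_kern] the last factor may become rho(t) - rho(th), th being the argument
    of z. This factor times |kern z t| is at most 6, so only the L1 norm of [kern w] remains, and
    the bound does not degrade as z approaches the circle. *)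
Lemma schwarz_increment rho z w : lip_periodic rho -> Cmod z < 1 -> Cmod w < 1 ->
  Cmod (schwarz rho z - schwarz rho w) <= 6 / PI * (Cmod (z - w) * kern_L1 w).
Proof.
  intros [Hl Hp] Hz Hw. assert (HPI := PI_RGT_0).
  assert (Hc : forall t, continuous rho t) by (intros; now apply lip_continuous).
  destruct (Ceq_dec z w) as [->|Hn].
  { replace (schwarz rho w - schwarz rho w)%C with (RtoC 0) by ring.
    replace (w - w)%C with (RtoC 0) by ring. rewrite Cmod_0. lra. }
  destruct (polar_form z) as [th Hth].
  assert (Hc' : forall t, continuous (fun t => rho t - rho th) t).
  { intros t; apply (continuous_minus (V := R_NormedModule)); [apply Hc|apply continuous_const]. }
  assert (E : (schwarz rho z - schwarz rho w)%C = (RtoC (/ PI) * ((z - w) *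
    cint (fun t => kern z t * kern w t * cis (- t) * RtoC (rho t - rho th)) (th - PI) (th + PI)))%C).
  { replace (th + PI) with (th - PI + 2 * PI) by ring.
    rewrite cint_periodic.
    2:{ intros; ccont. }
    2:{ intros t; rewrite !kern_periodic, Hp. do 2 f_equal.
        rewrite <- (cis_2PI (- (t + 2 * PI))). f_equal; ring. }
    rewrite (cint_ext (fun t => kern z t * kern w t * cis (- t) * RtoC (rho t - rho th))%C
      (fun t => kern z t * kern w t * cis (- t) * RtoC (rho t) - RtoC (rho th) * (kern z t * kern w t * cis (- t)))%C)
      by (intros t; rewrite RtoC_minus; ring).
    rewrite cint_minus, cint_scal, cint_kern_kern by (try assumption; apply cex_cont_all; intros; ccont).
    rewrite Cmult_0_r. unfold Cminus at 3. rewrite Copp_0, Cplus_0_r.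
    rewrite <- cint_scal by (apply cex_cont_all; intros; ccont).
    unfold schwarz.
    replace (RtoC (/ PI)) with (RtoC (/ (2 * PI)) * RtoC 2)%C
      by (rewrite <- RtoC_mult; f_equal; field; lra).
    match goal with |- (?a * ?x - ?a * ?y)%C = (_ * ?e)%C =>
      replace (a * x - a * y)%C with (a * (x - y))%C by ring;
      replace (a * 2 * e)%C with (a * (2 * e))%C by ring
    end.
    rewrite <- cint_scal by (apply cex_cont_all; intros; ccont).
    f_equal. rewrite <- cint_minus by (apply cex_cont_all; intros; ccont).
    apply cint_ext; intros t.
    transitivity (2 * (kern z t - kern w t) * RtoC (rho t))%C; [ring|].
    rewrite kern_diff by assumption. ring. }
  rewrite E, !Cmod_mult, Cmod_R, Rabs_pos_eq by (left; now apply Rinv_0_lt_compat).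
  replace (6 / PI * (Cmod (z - w) * kern_L1 w)) with (/ PI * (Cmod (z - w) * (6 * kern_L1 w))) by (field; lra).
  apply Rmult_le_compat_l; [left; now apply Rinv_0_lt_compat|].
  apply Rmult_le_compat_l; [apply Cmod_ge_0|].
  rewrite <- (kern_L1_window w th Hw).
  assert (Hk : forall t, continuous (fun t => Cmod (kern w t)) t)
    by (intros t; apply continuous_Cmod; now apply kern_cont).
  assert (Hs := RInt_scal (V := R_CompleteNormedModule) _ (th - PI) (th + PI) 6 (ex_RInt_cont _ _ _ Hk)).
  change (RInt (fun t => 6 * Cmod (kern w t)) (th - PI) (th + PI) =
    6 * RInt (fun t => Cmod (kern w t)) (th - PI) (th + PI)) in Hs.
  rewrite <- Hs.
  apply cint_norm_le; [lra| | |].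
  - apply cex_cont_all; intros; ccont.
  - apply ex_RInt_cont; intros t. apply (continuous_scal_r (V := R_NormedModule) 6), Hk.
  - intros t Ht. rewrite !Cmod_mult, Cmod_cis, Cmod_R, Rmult_1_r.
    rewrite kern_Cmod by assumption.
    assert (Hb : Rabs (t - th) <= 6 * Cmod (1 - z * cis (- t))).
    { rewrite Hth, denom_polar. apply Cmod_denom_lower; [generalize (Cmod_ge_0 z); lra|]. apply Rabs_le; lra. }
    assert (Hm := kern_denom_ge z t). set (m := Cmod (1 - z * cis (- t))) in *.
    specialize (Hl t th). assert (H0 := Cmod_ge_0 (kern w t)).
    replace (/ m * Cmod (kern w t) * Rabs (rho t - rho th)) with (Rabs (rho t - rho th) / m * Cmod (kern w t)) by (field; lra).
    apply Rmult_le_compat_r; [exact H0|].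
    apply (Rmult_le_reg_r m); [lra|]. unfold Rdiv. rewrite Rmult_assoc, Rinv_l by lra. lra.
Qed.

(** The right-hand side is the Poisson kernel. *)
Lemma kern_real_part z t : Cmod z < 1 ->
  fst (2 * kern z t - 1)%C = (1 - Cmod z ^ 2) * Cmod (kern z t) ^ 2.
Proof.
  intros Hz. rewrite kern_Cmod by exact Hz.
  assert (Hm := kern_denom_ge z t).
  assert (Hs := Cmod_sqr (1 - z * cis (- t))%C).
  assert (Hu := Cmod_sqr (z * cis (- t))%C). rewrite Cmod_mult_cis in Hu.
  unfold kern. set (u := (z * cis (- t))%C) in *. destruct u as [x y].
  set (m := Cmod (1 - (x, y))) in *. simpl in Hs, Hu.
  unfold Cinv; simpl.
  replace ((1 + - x) * ((1 + - x) * 1) + (0 + - y) * ((0 + - y) * 1)) with (m * m) by lra.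
  apply (Rmult_eq_reg_r (m * m)); [|nra]. field_simplify; [|lra|lra]. nra.
Qed.

(** The Poisson kernel times |t - th| is at most 6 (1 - r^2)/m, hence at most 12 (1 - r)/m, with m
    the modulus of the denominator. Since the L1 norm grows slower than 1/(1 - r), this yields the
    radial limit with an explicit rate. *)
Lemma schwarz_real_part rho r th : lip_periodic rho -> 0 <= r < 1 ->
  Rabs (fst (schwarz rho (RtoC r * cis th)) - rho th) <=
  6 / PI * ((1 - r) * kern_L1 (RtoC r * cis th)).
Proof.
  intros H Hr. assert (HPI := PI_RGT_0).
  set (z := (RtoC r * cis th)%C).
  assert (Ez : Cmod z = r) by (unfold z; rewrite Cmod_mult_cis, Cmod_R; apply Rabs_pos_eq; lra).
  assert (Hz : Cmod z < 1) by lra.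
  assert (E := f_equal fst (schwarz_sub_const rho th z H Hz)).
  destruct H as [Hl Hp].
  assert (Hc : forall t, continuous rho t) by (intros; now apply lip_continuous).
  assert (Hc' : forall t, continuous (fun t => rho t - rho th) t).
  { intros t; apply (continuous_minus (V := R_NormedModule)); [apply Hc|apply continuous_const]. }
  set (F := fun t => ((2 * kern z t - 1) * RtoC (rho t - rho th))%C) in E.
  change (fst (schwarz rho z) - rho th = / (2 * PI) * RInt (fun t => fst (F t)) (th - PI) (th + PI) -
    0 * RInt (fun t => snd (F t)) (th - PI) (th + PI)) in E.
  rewrite Rmult_0_l, Rminus_0_r in E. rewrite E.
  rewrite Rabs_mult, Rabs_pos_eq by (left; apply Rinv_0_lt_compat; lra).
  replace (6 / PI * ((1 - r) * kern_L1 z)) with (/ (2 * PI) * (12 * (1 - r) * kern_L1 z)) by (field; lra).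
  apply Rmult_le_compat_l; [left; apply Rinv_0_lt_compat; lra|].
  rewrite <- (kern_L1_window z th Hz).
  assert (Hk : forall t, continuous (fun t => Cmod (kern z t)) t)
    by (intros t; apply continuous_Cmod; now apply kern_cont).
  assert (Hs := RInt_scal (V := R_CompleteNormedModule) _ (th - PI) (th + PI) (12 * (1 - r)) (ex_RInt_cont _ _ _ Hk)).
  change (RInt (fun t => 12 * (1 - r) * Cmod (kern z t)) (th - PI) (th + PI) =
    12 * (1 - r) * RInt (fun t => Cmod (kern z t)) (th - PI) (th + PI)) in Hs.
  rewrite <- Hs.
  apply RInt_abs_le; [lra| | |].
  - assert (HF : forall t, ccont_at F t) by (intros t; unfold F; ccont).
    apply ex_RInt_cont; intros t; exact (proj1 (HF t)).
  - apply ex_RInt_cont; intros t. apply (continuous_scal_r (V := R_NormedModule) (12 * (1 - r))), Hk.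
  - intros t Ht. unfold F.
    replace (fst ((2 * kern z t - 1) * RtoC (rho t - rho th))%C) with (fst (2 * kern z t - 1)%C * (rho t - rho th)) by (simpl; ring).
    rewrite kern_real_part, Ez, Rabs_mult by exact Hz.
    assert (Hb : Rabs (t - th) <= 6 * Cmod (1 - z * cis (- t))).
    { unfold z; rewrite denom_polar. apply Cmod_denom_lower; [lra|]. apply Rabs_le; lra. }
    assert (Hm := kern_denom_ge z t). specialize (Hl t th).
    rewrite kern_Cmod by exact Hz. set (m := Cmod (1 - z * cis (- t))) in *.
    assert (Hi : 0 < / m) by (apply Rinv_0_lt_compat; lra).
    rewrite (Rabs_pos_eq ((1 - r ^ 2) * (/ m) ^ 2)).
    2:{ apply Rmult_le_pos; [nra|apply pow2_ge_0]. }
    apply Rle_trans with ((1 - r ^ 2) * (/ m) ^ 2 * (6 * m)).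
    { apply Rmult_le_compat_l; [apply Rmult_le_pos; [nra|apply pow2_ge_0]|lra]. }
    replace ((1 - r ^ 2) * (/ m) ^ 2 * (6 * m)) with (6 * (1 - r ^ 2) * / m) by (field; lra).
    apply Rmult_le_compat_r; nra.
Qed.

(** The conjugate Poisson kernel is -2r sin u / m^2. With v = u/2 the left-hand side is 8r v sin v
    cos v / m^2, and m^2 >= 4r sin^2 v reduces the claim to [x_cot_le], uniformly in r. *)
Lemma kern_imag_part r u : 0 <= r < 1 -> Rabs u <= PI ->
  Rabs (snd (2 * / (1 - RtoC r * cis (- u)) - 1)%C) * Rabs u <= 2 - u ^ 2 / 6.
Proof.
  intros Hr Hu.
  assert (Hg : 1 - Cmod (RtoC r) <= Cmod (1 - RtoC r * cis (- u))) by apply kern_denom_ge.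
  rewrite Cmod_R, Rabs_pos_eq in Hg by lra.
  assert (Hs := Cmod_denom_sqr r u).
  assert (E : snd (2 * / (1 - RtoC r * cis (- u)) - 1)%C = - (2 * r * sin u) / Cmod (1 - RtoC r * cis (- u)) ^ 2).
  { rewrite Cmod2_alt. unfold Re, Im, cis; simpl. rewrite sin_neg, cos_neg. field.
    intros H0. apply (Rlt_irrefl 0). apply Rlt_le_trans with (Cmod (1 - RtoC r * cis (- u)) ^ 2); [apply pow_lt; lra|].
    right. rewrite Cmod2_alt. unfold Re, Im, cis; simpl. rewrite sin_neg, cos_neg. etransitivity; [|exact H0]. ring. }
  rewrite E. set (m := Cmod (1 - RtoC r * cis (- u))) in *.
  assert (Hm : 0 < m ^ 2) by (apply pow_lt; lra).
  rewrite <- Rabs_mult.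
  assert (Hsin : sin u = 2 * sin (u / 2) * cos (u / 2)).
  { rewrite <- sin_2a. f_equal; field. }
  set (v := u / 2) in *.
  assert (Huv : u = 2 * v) by (unfold v; field).
  assert (Hv : - (PI / 2) <= v <= PI / 2) by (apply Rabs_le_between in Hu; lra).
  assert (HPI := PI_RGT_0).
  assert (Hkey : 0 <= v * sin v * cos v <= (1 - v ^ 2 / 3) * sin v ^ 2).
  { assert (Hcos : 0 <= cos v) by (apply cos_ge_0; lra).
    destruct (Rle_dec 0 v) as [H|H].
    - assert (S := sin_ge_0 v H ltac:(lra)). assert (K := x_cot_le v ltac:(lra)).
      split; [repeat apply Rmult_le_pos; lra|].
      replace (v * sin v * cos v) with (sin v * (v * cos v)) by ring.
      replace ((1 - v ^ 2 / 3) * sin v ^ 2) with (sin v * ((1 - v ^ 2 / 3) * sin v)) by ring.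
      apply Rmult_le_compat_l; lra.
    - assert (S := sin_ge_0 (- v) ltac:(lra) ltac:(lra)). assert (K := x_cot_le (- v) ltac:(lra)).
      rewrite sin_neg, cos_neg in *.
      split; [replace (v * sin v) with ((- v) * (- sin v)) by ring; repeat apply Rmult_le_pos; lra|].
      replace (v * sin v * cos v) with (- sin v * (- v * cos v)) by ring.
      replace ((1 - v ^ 2 / 3) * sin v ^ 2) with (- sin v * ((1 - (- v) ^ 2 / 3) * - sin v)) by field.
      apply Rmult_le_compat_l; lra. }
  replace (- (2 * r * sin u) / m ^ 2 * u) with (- (8 * r * (v * sin v * cos v) / m ^ 2)) by (rewrite Hsin, Huv; field; lra).
  rewrite Rabs_Ropp, Rabs_pos_eq.
  2:{ apply Rmult_le_pos; [apply Rmult_le_pos; lra|left; now apply Rinv_0_lt_compat]. }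
  apply (Rmult_le_reg_r (m ^ 2)); [exact Hm|].
  unfold Rdiv at 1. rewrite Rmult_assoc, Rinv_l, Rmult_1_r by lra.
  rewrite Hs.
  replace (2 - u ^ 2 / 6) with (2 * (1 - v ^ 2 / 3)) by (rewrite Huv; field).
  (* Read off from [Hkey] by dividing by sin^2 v; in the given range sin v vanishes only at v =
     0. *)
  assert (Hv2 : 0 <= 1 - v ^ 2 / 3).
  { destruct (Req_dec (sin v) 0) as [E0|E0].
    - assert (v = 0); [|subst v; rewrite H; lra].
      destruct (Rtotal_order v 0) as [H|[H|H]]; [|exact H|].
      + exfalso. assert (K := sin_gt_0 (- v) ltac:(lra) ltac:(lra)). rewrite sin_neg in K; lra.
      + exfalso. assert (K := sin_gt_0 v ltac:(lra) ltac:(lra)). lra.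
    - assert (0 < sin v ^ 2) by (apply pow2_gt_0; exact E0).
      apply (Rmult_le_reg_r (sin v ^ 2)); [assumption|]. lra. }
  assert (0 <= (1 - v ^ 2 / 3) * (1 - r) ^ 2) by (apply Rmult_le_pos; [exact Hv2|apply pow2_ge_0]).
  set (q := v * sin v * cos v) in *. set (p := (1 - v ^ 2 / 3)) in *.
  assert (r * q <= r * (p * sin v ^ 2)) by (apply Rmult_le_compat_l; lra).
  lra.
Qed.

(** Subtracting the real constant rho(th) leaves the imaginary part unchanged. What remains is the
    mean of 2 - u^2/6 over [-pi, pi], that is (4 pi - pi^3/9) / (2 pi). *)
Lemma schwarz_imag_part rho z : lip_periodic rho -> Cmod z < 1 ->
  Rabs (snd (schwarz rho z)) <= 2 - PI ^ 2 / 18.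
Proof.
  intros H Hz. assert (HPI := PI_RGT_0).
  destruct (polar_form z) as [th Hth].
  assert (E := f_equal snd (schwarz_sub_const rho th z H Hz)).
  destruct H as [Hl Hp].
  assert (Hc : forall t, continuous rho t) by (intros; now apply lip_continuous).
  assert (Hc' : forall t, continuous (fun t => rho t - rho th) t).
  { intros t; apply (continuous_minus (V := R_NormedModule)); [apply Hc|apply continuous_const]. }
  set (F := fun t => ((2 * kern z t - 1) * RtoC (rho t - rho th))%C) in E.
  change (snd (schwarz rho z) + - 0 = / (2 * PI) * RInt (fun t => snd (F t)) (th - PI) (th + PI) +
    0 * RInt (fun t => fst (F t)) (th - PI) (th + PI)) in E.
  rewrite Rmult_0_l, Ropp_0, !Rplus_0_r in E. rewrite E.
  rewrite Rabs_mult, Rabs_pos_eq by (left; apply Rinv_0_lt_compat; lra).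
  assert (Hi : is_RInt (fun t => 2 - (t - th) ^ 2 / 6) (th - PI) (th + PI) (4 * PI - PI ^ 3 / 9)).
  { replace (4 * PI - PI ^ 3 / 9) with
      (minus (2 * (th + PI) - (th + PI - th) ^ 3 / 18) (2 * (th - PI) - (th - PI - th) ^ 3 / 18))
      by (unfold minus, plus, opp; simpl; field).
    apply (is_RInt_derive (fun t => 2 * t - (t - th) ^ 3 / 18)); intros t _.
    - auto_derive; auto; field.
    - apply (ex_derive_continuous (V := R_NormedModule)). auto_derive; auto. }
  replace (2 - PI ^ 2 / 18) with (/ (2 * PI) * (4 * PI - PI ^ 3 / 9)) by (field; lra).
  apply Rmult_le_compat_l; [left; apply Rinv_0_lt_compat; lra|].
  rewrite <- (is_RInt_unique (V := R_CompleteNormedModule) _ _ _ _ Hi).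
  apply RInt_abs_le; [lra| |eexists; exact Hi|].
  - assert (HF : forall t, ccont_at F t) by (intros t; unfold F; ccont).
    apply ex_RInt_cont; intros t; exact (proj2 (HF t)).
  - intros t Ht. unfold F.
    replace (snd ((2 * kern z t - 1) * RtoC (rho t - rho th))%C) with (snd (2 * kern z t - 1)%C * (rho t - rho th)) by (simpl; ring).
    rewrite Rabs_mult, Hth, kern_polar.
    eapply Rle_trans; [|apply (kern_imag_part (Cmod z)); [generalize (Cmod_ge_0 z); lra|apply Rabs_le; lra]].
    apply Rmult_le_compat_l; [apply Rabs_pos|apply Hl].
Qed.

(* Stands in for complex differentiability: a second-order remainder, uniform on compact subdiscs,
   passes through the integrals over the circle and along rays without further limit arguments. *)
Definition quad_diff_disc (g g' : C -> C) : Prop :=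
  forall r, 0 < r < 1 -> exists M, 0 <= M /\ forall z w, Cmod z <= r -> Cmod w <= r ->
    Cmod (g z - g w - (z - w) * g' w) <= M * Cmod (z - w) ^ 2 /\ Cmod (g' w) <= M.

(** Two applications of [kern_diff] turn the remainder into (z - w)^2 times an integral of three
    kernels, each bounded by 1/(1 - r) on the subdisc. *)
Lemma schwarz_quad_diff rho : lip_periodic rho -> quad_diff_disc (schwarz rho) (schwarz_deriv rho).
Proof.
  intros H r Hr. assert (HPI := PI_RGT_0).
  destruct (lip_periodic_bounded rho H) as [B [HB HBt]].
  destruct H as [Hl Hp].
  assert (Hc : forall t, continuous rho t) by (intros; now apply lip_continuous).
  assert (Hr1 : 1 <= / (1 - r)) by (rewrite <- Rinv_1; apply Rinv_le_contravar; lra).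
  set (k := / (1 - r)) in *.
  (* The remainder needs three factors k and the derivative only two; k >= 1 lets one constant serve
     both. *)
  exists (2 * (k * k * k) * B).
  split; [repeat apply Rmult_le_pos; lra|].
  intros z w Hzr Hwr.
  assert (Hz : Cmod z < 1) by lra. assert (Hw : Cmod w < 1) by lra.
  assert (H2 : Cmod 2 = 2) by (rewrite Cmod_R; apply Rabs_pos_eq; lra).
  assert (Hkz := fun t => kern_Cmod_le z t r Hzr ltac:(lra)).
  assert (Hkw := fun t => kern_Cmod_le w t r Hwr ltac:(lra)). fold k in Hkz, Hkw.
  assert (Hmean : forall c M, 0 <= M -> Cmod c <= (2 * PI - 0) * M -> Cmod (RtoC (/ (2 * PI)) * c) <= M).
  { intros c M HM Hcm. rewrite Cmod_mult, Cmod_R, Rabs_pos_eq by (left; apply Rinv_0_lt_compat; lra).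
    apply (Rmult_le_reg_l (2 * PI)); [lra|]. rewrite <- Rmult_assoc, Rinv_r by lra. lra. }
  split.
  - assert (E : (schwarz rho z - schwarz rho w - (z - w) * schwarz_deriv rho w)%C =
      (RtoC (/ (2 * PI)) * cint (fun t => (z - w) * (z - w) * (2 * (cis (- t) * cis (- t)) * (kern z t * (kern w t * kern w t)) * RtoC (rho t))) 0 (2 * PI))%C).
    { unfold schwarz, schwarz_deriv.
      match goal with |- (?a * ?x - ?a * ?y - ?d * (?a * ?e))%C = _ =>
        replace (a * x - a * y - d * (a * e))%C with (a * (x - y - d * e))%C by ring end.
      f_equal. rewrite <- cint_scal by (apply cex_cont_all; intros; ccont).
      rewrite <- !cint_minus by (apply cex_cont_all; intros; ccont).
      apply cint_ext; intros t.
      transitivity ((2 * (kern z t - kern w t) - (z - w) * (2 * cis (- t) * (kern w t * kern w t))) * RtoC (rho t))%C; [ring|].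
      rewrite kern_diff by assumption.
      transitivity (2 * (z - w) * cis (- t) * kern w t * (kern z t - kern w t) * RtoC (rho t))%C; [ring|].
      rewrite kern_diff by assumption. ring. }
    rewrite E. apply Hmean.
    { apply Rmult_le_pos; [repeat apply Rmult_le_pos; lra|apply pow2_ge_0]. }
    apply cint_norm_le_const; [lra|apply cex_cont_all; intros; ccont|].
    intros t Ht. rewrite !Cmod_mult, Cmod_cis, H2, Cmod_R.
    specialize (HBt t Ht). specialize (Hkz t). specialize (Hkw t).
    assert (Hp1 := Cmod_ge_0 (kern z t)). assert (Hp2 := Cmod_ge_0 (kern w t)).
    replace (2 * (k * k * k) * B * Cmod (z - w) ^ 2) with (Cmod (z - w) * Cmod (z - w) * (2 * (1 * 1) * (k * (k * k)) * B)) by ring.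
    apply Rmult_le_compat_l; [generalize (Cmod_ge_0 (z - w)); nra|].
    assert (P2 : Cmod (kern w t) * Cmod (kern w t) <= k * k) by (apply Rmult_le_compat; assumption).
    assert (P3 : Cmod (kern z t) * (Cmod (kern w t) * Cmod (kern w t)) <= k * (k * k))
      by (apply Rmult_le_compat; try assumption; nra).
    apply Rmult_le_compat; [|apply Rabs_pos| |exact HBt].
    + repeat apply Rmult_le_pos; try assumption; lra.
    + apply Rmult_le_compat_l; lra.
  - unfold schwarz_deriv. apply Hmean; [repeat apply Rmult_le_pos; lra|].
    apply cint_norm_le_const; [lra|apply cex_cont_all; intros; ccont|].
    intros t Ht. rewrite !Cmod_mult, Cmod_cis, H2, Cmod_R.
    specialize (HBt t Ht). specialize (Hkw t).
    assert (Hp2 := Cmod_ge_0 (kern w t)).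
    assert (P2 : Cmod (kern w t) * Cmod (kern w t) <= k * k) by (apply Rmult_le_compat; assumption).
    apply Rmult_le_compat; [|apply Rabs_pos| |exact HBt].
    + repeat apply Rmult_le_pos; try assumption; lra.
    + assert (k * k <= k * k * k) by nra. nra.
Qed.

(** * Boundary values *)

(* Phrased with an upper bound [d > 0] of [|z - w|], as [Rpower 0 alpha = 1]. *)
Definition holder_d (A : C -> Prop) (alpha : R) (g : C -> C) : Prop :=
  exists K, 0 < K /\ forall z w d, A z -> A w -> 0 < d -> Cmod (z - w) <= d ->
    Cmod (g z - g w) <= K * Rpower d alpha.

Lemma Rpower_small alpha K e : 0 < alpha -> 0 < K -> 0 < e ->
  exists d, 0 < d /\ K * Rpower d alpha < e.
Proof.
  intros Ha HK He. exists (Rpower (e / (2 * K)) (/ alpha)). split; [apply exp_pos|].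
  assert (H : 0 < e / (2 * K)) by (apply Rdiv_lt_0_compat; lra).
  rewrite Rpower_mult, Rinv_l, Rpower_1 by lra.
  replace (K * (e / (2 * K))) with (e / 2) by (field; lra). lra.
Qed.

(** A Hardy-Littlewood argument. If w is at distance at least d from the circle, the increment is at
    most a multiple of d * d^(alpha - 1). Otherwise both points are first contracted by 1 - d, which
    provides that distance; the two radial moves and the middle one account for the factor 3. *)
Lemma schwarz_holder rho alpha : lip_periodic rho -> 0 < alpha < 1 ->
  holder_d unit_disc alpha (schwarz rho).
Proof.
  intros Hrho Ha. assert (HPI := PI_RGT_0).
  destruct (kern_L1_le (1 - alpha) ltac:(lra)) as [K0 [HK0 HK]].
  set (K := 6 / PI * K0).
  assert (HKp : 0 < K) by (apply Rmult_lt_0_compat; [apply Rdiv_lt_0_compat|]; lra).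
  assert (Hfar : forall z w d, Cmod z < 1 -> Cmod w < 1 -> 0 < d -> d <= 1 - Cmod w -> Cmod (z - w) <= d ->
    Cmod (schwarz rho z - schwarz rho w) <= K * Rpower d alpha).
  { intros z w d Hz Hw Hd Hdw Hzw.
    eapply Rle_trans; [now apply schwarz_increment|].
    unfold K. rewrite Rmult_assoc. apply Rmult_le_compat_l; [apply Rlt_le, Rdiv_lt_0_compat; lra|].
    specialize (HK w Hw).
    replace (K0 * Rpower d alpha) with (d * (K0 * Rpower d (- (1 - alpha)))).
    - apply Rmult_le_compat; [apply Cmod_ge_0|now apply kern_L1_nonneg|exact Hzw|].
      eapply Rle_trans; [exact HK|]. apply Rmult_le_compat_l; [lra|].
      rewrite !Rpower_Ropp. apply Rinv_le_contravar; [apply exp_pos|]. apply Rle_Rpower_l; lra.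
    - rewrite <- (Rpower_1 d) at 1 by exact Hd.
      replace (Rpower d 1 * (K0 * Rpower d (- (1 - alpha)))) with (K0 * (Rpower d 1 * Rpower d (- (1 - alpha)))) by ring.
      rewrite <- Rpower_plus. do 2 f_equal. ring. }
  exists (3 * K). split; [lra|].
  unfold unit_disc. intros z w d Hz Hw Hd Hzw.
  (* For d >= 1 contraction by 1 - d is meaningless; both values are compared with the one at 0,
     whose distance to the circle is 1. *)
  destruct (Rle_dec 1 d) as [H1|H1].
  - assert (HR : 1 <= Rpower d alpha).
    { rewrite <- (Rpower_O d) at 1 by lra. apply Rle_Rpower; lra. }
    assert (HR1 : Rpower 1 alpha = 1) by (unfold Rpower; rewrite ln_1, Rmult_0_r; apply exp_0).
    assert (H0 : Cmod (RtoC 0) < 1) by (rewrite Cmod_0; lra).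
    assert (Hc : forall x, Cmod x < 1 -> Cmod (schwarz rho x - schwarz rho (RtoC 0)) <= K).
    { intros x Hx. rewrite <- (Rmult_1_r K), <- HR1. apply Hfar; try assumption; try lra.
      - rewrite Cmod_0; lra.
      - replace (x - RtoC 0)%C with x by ring. lra. }
    eapply Rle_trans; [apply (Cmod_minus_triangle _ (schwarz rho (RtoC 0)))|].
    rewrite (Cmod_minus_sym (schwarz rho (RtoC 0))).
    generalize (Hc z Hz) (Hc w Hw). nra.
  - assert (Hsc : forall x, Cmod (RtoC (1 - d) * x) = (1 - d) * Cmod x).
    { intros x. rewrite Cmod_mult, Cmod_R, Rabs_pos_eq by lra. reflexivity. }
    assert (Hrad : forall x, Cmod x < 1 -> Cmod (schwarz rho x - schwarz rho (RtoC (1 - d) * x)) <= K * Rpower d alpha).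
    { intros x Hx. assert (H0 := Cmod_ge_0 x). apply Hfar; rewrite ?Hsc; try assumption; try nra.
      replace (x - RtoC (1 - d) * x)%C with (RtoC d * x)%C by (rewrite RtoC_minus; ring).
      rewrite Cmod_mult, Cmod_R, Rabs_pos_eq by lra. nra. }
    assert (Hmid : Cmod (schwarz rho (RtoC (1 - d) * z) - schwarz rho (RtoC (1 - d) * w)) <= K * Rpower d alpha).
    { assert (H0 := Cmod_ge_0 z). assert (H0' := Cmod_ge_0 w). assert (H0'' := Cmod_ge_0 (z - w)). apply Hfar; rewrite ?Hsc; try assumption; try nra.
      replace (RtoC (1 - d) * z - RtoC (1 - d) * w)%C with (RtoC (1 - d) * (z - w))%C by ring.
      rewrite Hsc. nra. }
    eapply Rle_trans; [apply (Cmod_minus_triangle _ (schwarz rho (RtoC (1 - d) * z)))|].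
    eapply Rle_trans; [apply Rplus_le_compat_l, (Cmod_minus_triangle _ (schwarz rho (RtoC (1 - d) * w)))|].
    rewrite (Cmod_minus_sym _ (schwarz rho w)).
    generalize (Hrad z Hz) (Hrad w Hw). lra.
Qed.

Definition clim (u : nat -> C) (l : C) : Prop := is_lim_seq (fun n => Cmod (u n - l)) 0.

Lemma clim_eps u l : (forall e, 0 < e -> exists N, forall n, (N <= n)%nat -> Cmod (u n - l) < e) -> clim u l.
Proof.
  intros H. apply is_lim_seq_spec. intros e. destruct (H e (cond_pos e)) as [N HN].
  exists N. intros n Hn. rewrite Rminus_0_r, Rabs_pos_eq by apply Cmod_ge_0. auto.
Qed.

Lemma clim_pair (u : nat -> C) (l : C) : is_lim_seq (fun n => fst (u n)) (fst l) -> is_lim_seq (fun n => snd (u n)) (snd l) -> clim u l.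
Proof.
  intros H1 H2. apply clim_eps. intros e He.
  apply is_lim_seq_spec in H1. apply is_lim_seq_spec in H2.
  assert (He2 : 0 < e / 2) by lra.
  destruct (H1 (mkposreal _ He2)) as [N1 HN1]. destruct (H2 (mkposreal _ He2)) as [N2 HN2]. simpl in *.
  exists (max N1 N2). intros n Hn.
  specialize (HN1 n ltac:(lia)). specialize (HN2 n ltac:(lia)).
  eapply Rle_lt_trans; [apply Cmod_le_fst_snd|]. simpl. unfold Rminus in *. lra.
Qed.

Lemma clim_proj (u : nat -> C) (l : C) : clim u l -> is_lim_seq (fun n => fst (u n)) (fst l) /\ is_lim_seq (fun n => snd (u n)) (snd l).
Proof.
  intros H. apply is_lim_seq_spec in H.
  split; apply is_lim_seq_spec; intros e; destruct (H e) as [N HN]; exists N; intros n Hn;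
    specialize (HN n Hn); rewrite Rminus_0_r, Rabs_pos_eq in HN by apply Cmod_ge_0;
    (eapply Rle_lt_trans; [|exact HN]).
  - apply (Cmod_fst (u n - l)).
  - apply (Cmod_snd (u n - l)).
Qed.

Lemma clim_minus_le u v l m M : (forall n, Cmod (u n - v n) <= M) -> clim u l -> clim v m -> Cmod (l - m) <= M.
Proof.
  intros H Hu Hv.
  assert (Hlim : is_lim_seq (fun n => Cmod (u n - l) + (M + Cmod (v n - m))) (0 + (M + 0))).
  { apply is_lim_seq_plus'; [exact Hu|]. apply is_lim_seq_plus'; [apply is_lim_seq_const|exact Hv]. }
  assert (E : Rbar_le (Cmod (l - m)) (0 + (M + 0))).
  { refine (is_lim_seq_le (fun _ => Cmod (l - m)) _ _ _ _ (is_lim_seq_const _) Hlim).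
    intros n. specialize (H n).
    eapply Rle_trans; [apply (Cmod_minus_triangle _ (u n))|]. rewrite (Cmod_minus_sym l).
    apply Rplus_le_compat_l.
    eapply Rle_trans; [apply (Cmod_minus_triangle _ (v n))|]. lra. }
  simpl in E. lra.
Qed.

Lemma clim_unique u l m : clim u l -> clim u m -> l = m.
Proof.
  intros Hl Hm.
  assert (H : Cmod (l - m) <= 0).
  { apply (clim_minus_le u u l m 0); auto. intros n. replace (u n - u n)%C with (RtoC 0) by ring. rewrite Cmod_0; lra. }
  assert (H0 : (l - m)%C = RtoC 0) by (apply Cmod_eq_0; generalize (Cmod_ge_0 (l - m)); lra).
  replace l with (l - m + m)%C by ring. rewrite H0; ring.
Qed.

(** The shift by 2 keeps every radius strictly between 0 and 1, including n = 0. *)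
Definition radius (n : nat) : R := 1 - / (INR n + 2).

Lemma radius_bounds n : 0 < radius n < 1.
Proof.
  unfold radius. assert (H := pos_INR n).
  assert (0 < / (INR n + 2)) by (apply Rinv_0_lt_compat; lra).
  assert (/ (INR n + 2) <= / 2) by (apply Rinv_le_contravar; lra). lra.
Qed.

Lemma radius_close e : 0 < e -> exists N, forall n, (N <= n)%nat -> 1 - radius n < e.
Proof.
  intros He. destruct (archimed_cor1 e He) as [N [HN HN0]]. exists N. intros n Hn.
  unfold radius. apply le_INR in Hn. apply lt_INR in HN0. simpl in HN0.
  replace (1 - (1 - / (INR n + 2))) with (/ (INR n + 2)) by ring.
  eapply Rle_lt_trans; [|exact HN]. apply Rinv_le_contravar; lra.
Qed.

(** Retracting first makes the extension a total function on the plane, with its bounds valid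
    everywhere, so later estimates carry no domain conditions. *)
Definition disc_proj (z : C) : C := (RtoC (/ Rmax 1 (Cmod z)) * z)%C.

Lemma disc_proj_le z : Cmod (disc_proj z) <= 1.
Proof.
  unfold disc_proj. assert (H := Rmax_l 1 (Cmod z)). assert (H' := Rmax_r 1 (Cmod z)).
  rewrite Cmod_mult, Cmod_R, Rabs_pos_eq by (left; apply Rinv_0_lt_compat; lra).
  apply (Rmult_le_reg_l (Rmax 1 (Cmod z))); [lra|]. rewrite <- Rmult_assoc, Rinv_r by lra. lra.
Qed.

Lemma disc_proj_id z : Cmod z <= 1 -> disc_proj z = z.
Proof. intros H. unfold disc_proj. rewrite Rmax_left by lra. rewrite Rinv_1. ring. Qed.

(** With a, b the two normalising factors, z/a - w/b = (1/a)((z - w) + ((b - a)/b) w). Here a >= 1,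
    |w| <= b and |b - a| <= |z - w|. *)
Lemma disc_proj_lip z w : Cmod (disc_proj z - disc_proj w) <= 2 * Cmod (z - w).
Proof.
  unfold disc_proj.
  assert (Ha := Rmax_l 1 (Cmod z)). assert (Hb := Rmax_l 1 (Cmod w)). assert (Hb' := Rmax_r 1 (Cmod w)).
  assert (Hab : Rabs (Rmax 1 (Cmod w) - Rmax 1 (Cmod z)) <= Cmod (z - w)).
  { assert (H1 := Cmod_le_plus_minus z w). assert (H2 := Cmod_le_plus_minus w z).
    rewrite (Cmod_minus_sym w) in H2. assert (H3 := Cmod_ge_0 (z - w)).
    apply Rabs_le. unfold Rmax; destruct (Rle_dec 1 (Cmod z)), (Rle_dec 1 (Cmod w)); lra. }
  set (a := Rmax 1 (Cmod z)) in *. set (b := Rmax 1 (Cmod w)) in *.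
  assert (E : (RtoC (/ a) * z - RtoC (/ b) * w)%C = (RtoC (/ a) * ((z - w) + RtoC ((b - a) / b) * w))%C).
  { replace (RtoC (/ b)) with (RtoC (/ a * (1 - (b - a) / b))) by (f_equal; field; lra).
    rewrite RtoC_mult, RtoC_minus. ring. }
  rewrite E, Cmod_mult, Cmod_R, Rabs_pos_eq by (left; apply Rinv_0_lt_compat; lra).
  assert (Ht := Cmod_triangle (z - w) (RtoC ((b - a) / b) * w)).
  assert (Hw : Cmod (RtoC ((b - a) / b) * w) <= Cmod (z - w)).
  { rewrite Cmod_mult, Cmod_R. unfold Rdiv. rewrite Rabs_mult, (Rabs_pos_eq (/ b)) by (left; apply Rinv_0_lt_compat; lra).
    apply Rle_trans with (Rabs (b - a) * 1); [|lra]. rewrite Rmult_assoc. apply Rmult_le_compat_l; [apply Rabs_pos|].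
    apply (Rmult_le_reg_l b); [lra|]. rewrite <- Rmult_assoc, Rinv_r by lra. lra. }
  assert (Hi : / a <= 1) by (rewrite <- Rinv_1; apply Rinv_le_contravar; lra).
  assert (Hi0 : 0 < / a) by (apply Rinv_0_lt_compat; lra).
  assert (H0 := Cmod_ge_0 (z - w + RtoC ((b - a) / b) * w)). nra.
Qed.

Definition approx (n : nat) (z : C) : C := (RtoC (radius n) * disc_proj z)%C.

Lemma approx_in_disc n z : unit_disc (approx n z).
Proof.
  unfold unit_disc, approx. rewrite Cmod_mult, Cmod_R. assert (H := radius_bounds n).
  rewrite Rabs_pos_eq by lra. generalize (disc_proj_le z) (Cmod_ge_0 (disc_proj z)). nra.
Qed.

Lemma approx_close n z : Cmod (approx n z - disc_proj z) <= 1 - radius n.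
Proof.
  unfold approx. replace (RtoC (radius n) * disc_proj z - disc_proj z)%C with (RtoC (radius n - 1) * disc_proj z)%C
    by (rewrite RtoC_minus; ring).
  assert (H := radius_bounds n). rewrite Cmod_mult, Cmod_R, Rabs_left by lra.
  generalize (disc_proj_le z) (Cmod_ge_0 (disc_proj z)). nra.
Qed.

(** The Hoelder bound makes the values along increasing radii a Cauchy sequence, and the limit
    inherits the bound up to the factor 2^alpha due to [disc_proj_lip]. The last conclusion serves
    to pass pointwise bounds and boundary values to the limit. *)
Lemma holder_extension alpha g : 0 < alpha -> holder_d unit_disc alpha g ->
  exists G, holder_d (fun _ => True) alpha G /\
    (forall z, unit_disc z -> G z = g z) /\
    (forall z, clim (fun n => g (approx n z)) (G z)).
Proof.
  intros Ha [K [HK HH]].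
  (* [Lim_seq] is total and [real] sends infinite limits to 0; [Hcauchy] shows that the limits are
     genuine and finite. *)
  exists (fun z => (real (Lim_seq (fun n => fst (g (approx n z)))), real (Lim_seq (fun n => snd (g (approx n z)))))).
  assert (Hcauchy : forall z e, 0 < e -> exists N, forall n m, (N <= n)%nat -> (N <= m)%nat ->
    Cmod (g (approx n z) - g (approx m z)) < e).
  { intros z e He. destruct (Rpower_small alpha K e Ha HK He) as [d [Hd Hde]].
    destruct (radius_close (d / 2) ltac:(lra)) as [N HN]. exists N. intros n m Hn Hm.
    eapply Rle_lt_trans; [|exact Hde]. apply HH; try apply approx_in_disc; try exact Hd.
    eapply Rle_trans; [apply (Cmod_minus_triangle _ (disc_proj z))|].
    rewrite (Cmod_minus_sym (disc_proj z)).
    generalize (approx_close n z) (approx_close m z) (HN n Hn) (HN m Hm). lra. }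
  assert (Hlim : forall z, clim (fun n => g (approx n z))
    (real (Lim_seq (fun n => fst (g (approx n z)))), real (Lim_seq (fun n => snd (g (approx n z)))))).
  { intros z. apply clim_pair; simpl; apply Lim_seq_correct', ex_lim_seq_cauchy_corr; intros e;
      destruct (Hcauchy z e (cond_pos e)) as [N HN]; exists N; intros n m Hn Hm;
      (eapply Rle_lt_trans; [|apply (HN n m Hn Hm)]).
    - apply (Cmod_fst (g (approx n z) - g (approx m z))).
    - apply (Cmod_snd (g (approx n z) - g (approx m z))). }
  split; [|split; [|exact Hlim]].
  - exists (K * Rpower 2 alpha). split; [apply Rmult_lt_0_compat; [exact HK|apply exp_pos]|].
    intros z w d _ _ Hd Hzw.
    apply (clim_minus_le (fun n => g (approx n z)) (fun n => g (approx n w))); try apply Hlim.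
    intros n. rewrite Rmult_assoc, Rpower_mult_distr by lra.
    apply HH; try apply approx_in_disc; [lra|].
    unfold approx. replace (RtoC (radius n) * disc_proj z - RtoC (radius n) * disc_proj w)%C
      with (RtoC (radius n) * (disc_proj z - disc_proj w))%C by ring.
    assert (H := radius_bounds n). rewrite Cmod_mult, Cmod_R, Rabs_pos_eq by lra.
    assert (H1 := disc_proj_lip z w). generalize (Cmod_ge_0 (disc_proj z - disc_proj w)). nra.
  - intros z Hz. eapply clim_unique; [apply Hlim|].
    apply clim_eps. intros e He. destruct (Rpower_small alpha K e Ha HK He) as [d [Hd Hde]].
    destruct (radius_close d Hd) as [N HN]. exists N. intros n Hn.
    eapply Rle_lt_trans; [|exact Hde]. apply HH; try apply approx_in_disc; try assumption.
    rewrite <- (disc_proj_id z) at 2 by (unfold unit_disc in Hz; lra).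
    generalize (approx_close n z) (HN n Hn). lra.
Qed.

Lemma schwarz_extension rho alpha : lip_periodic rho -> 0 < alpha < 1 ->
  exists H, holder_d (fun _ => True) alpha H /\
    (forall z, unit_disc z -> H z = schwarz rho z) /\
    (forall th, fst (H (cis th)) = rho th) /\
    (forall z, Rabs (snd (H z)) <= 2 - PI ^ 2 / 18) /\
    (exists M, forall z, Cmod (H z) <= M).
Proof.
  intros Hrho Ha. assert (HPI := PI_RGT_0).
  assert (Hh := schwarz_holder rho alpha Hrho Ha).
  destruct (holder_extension alpha _ (proj1 Ha) Hh) as [H [HH [Hin Hlim]]].
  exists H. split; [exact HH|split; [exact Hin|split; [|split]]].
  - intros th. destruct (clim_proj _ _ (Hlim (cis th))) as [H1 _].
    enough (H2 : is_lim_seq (fun n => fst (schwarz rho (approx n (cis th)))) (rho th)).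
    { apply is_lim_seq_unique in H1. apply is_lim_seq_unique in H2. rewrite H1 in H2. now injection H2. }
    destruct (kern_L1_le (1 - alpha) ltac:(lra)) as [K [HK HKL]].
    apply is_lim_seq_spec. intros e.
    destruct (Rpower_small alpha (6 / PI * K) e) as [d [Hd Hde]];
      [lra|apply Rmult_lt_0_compat; [apply Rdiv_lt_0_compat|]; lra|apply cond_pos|].
    destruct (radius_close d Hd) as [N HN]. exists N. intros n Hn.
    assert (Hr := radius_bounds n). specialize (HN n Hn).
    assert (Hap : approx n (cis th) = (RtoC (radius n) * cis th)%C).
    { unfold approx. rewrite disc_proj_id; [reflexivity|]. rewrite Cmod_cis; lra. }
    rewrite Hap. eapply Rle_lt_trans; [apply schwarz_real_part; [exact Hrho|lra]|].
    eapply Rle_lt_trans; [|exact Hde]. rewrite Rmult_assoc.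
    apply Rmult_le_compat_l; [apply Rlt_le, Rdiv_lt_0_compat; lra|].
    assert (Hc : Cmod (RtoC (radius n) * cis th) = radius n).
    { rewrite Cmod_mult_cis, Cmod_R. apply Rabs_pos_eq; lra. }
    specialize (HKL (RtoC (radius n) * cis th)%C). rewrite Hc in HKL. specialize (HKL ltac:(lra)).
    apply Rle_trans with ((1 - radius n) * (K * Rpower (1 - radius n) (- (1 - alpha)))).
    { apply Rmult_le_compat_l; lra. }
    apply Rle_trans with (K * Rpower (1 - radius n) alpha).
    2:{ apply Rmult_le_compat_l; [lra|]. apply Rle_Rpower_l; lra. }
    (* The linear rate absorbs the growth of the L1 norm: (1 - r)(1 - r)^(-(1 - alpha)) = (1 -
       r)^alpha, which tends to 0. *)
    right. rewrite <- (Rpower_1 (1 - radius n)) at 1 by lra.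
    replace alpha with (1 + - (1 - alpha)) at 2 by ring. rewrite Rpower_plus. ring.
  - intros z. destruct (clim_proj _ _ (Hlim z)) as [_ H2].
    assert (Hb : forall n, Rabs (snd (schwarz rho (approx n z))) <= 2 - PI ^ 2 / 18)
      by (intros n; apply schwarz_imag_part; [exact Hrho|apply approx_in_disc]).
    apply is_lim_seq_abs in H2.
    exact (is_lim_seq_le _ _ _ _ Hb H2 (is_lim_seq_const _)).
  - destruct Hh as [K [HK HKh]].
    exists (Cmod (schwarz rho (RtoC 0)) + K * Rpower 1 alpha). intros z.
    replace (H z) with (H z - RtoC 0)%C by ring.
    apply (clim_minus_le (fun n => schwarz rho (approx n z)) (fun _ => RtoC 0)); [|apply Hlim|].
    + intros n. replace (schwarz rho (approx n z) - RtoC 0)%C with (schwarz rho (approx n z)) by ring.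
      eapply Rle_trans; [apply (Cmod_le_plus_minus _ (schwarz rho (RtoC 0)))|].
      apply Rplus_le_compat_l, HKh; [apply approx_in_disc| |lra|].
      * unfold unit_disc; rewrite Cmod_0; lra.
      * replace (approx n z - RtoC 0)%C with (approx n z) by ring.
        generalize (approx_in_disc n z); unfold unit_disc; lra.
    + apply clim_eps. intros e He. exists O. intros n _.
      replace (RtoC 0 - RtoC 0)%C with (RtoC 0) by ring. rewrite Cmod_0. exact He.
Qed.

(** * The complex exponential *)

Definition cexp (z : C) : C := (exp (fst z) * cos (snd z), exp (fst z) * sin (snd z)).

Lemma cexp_plus z w : cexp (z + w) = (cexp z * cexp w)%C.
Proof.
  unfold cexp; apply injective_projections; simpl; rewrite exp_plus.
  - rewrite cos_plus; ring.
  - rewrite sin_plus; ring.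
Qed.

Lemma Cmod_cexp z : Cmod (cexp z) = exp (fst z).
Proof.
  replace (cexp z) with (RtoC (exp (fst z)) * cis (snd z))%C.
  - rewrite Cmod_mult_cis, Cmod_R. apply Rabs_pos_eq, Rlt_le, exp_pos.
  - apply injective_projections; simpl; ring.
Qed.

Lemma exp_le_compat x y : x <= y -> exp x <= exp y.
Proof. intros [H| ->]; [left; now apply exp_increasing|right; reflexivity]. Qed.

Lemma Cmod_cexp_le z R0 : Cmod z <= R0 -> Cmod (cexp z) <= exp R0.
Proof.
  intros H. rewrite Cmod_cexp. apply exp_le_compat. assert (H1 := Cmod_fst z).
  apply Rabs_le_between in H1. lra.
Qed.

Lemma sin_minus_id_le y : Rabs (sin y - y) <= y ^ 2 / 2.
Proof.
  assert (Hpos : forall x, 0 <= x -> 0 <= x - sin x <= x ^ 2 / 2).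
  { intros x Hx. split.
    - destruct (Req_dec x 0) as [->|Hn]; [rewrite sin_0; lra|].
      generalize (sin_lt_x x ltac:(lra)); lra.
    - enough (0 <= x ^ 2 / 2 - x + sin x) by lra.
      apply (mono_from_0 (fun x => x ^ 2 / 2 - x + sin x) (fun x => x - 1 + cos x) x); [| | |lra].
      + intros t; auto_derive; auto; field.
      + rewrite sin_0; field.
      + apply (mono_from_0 (fun x => x - 1 + cos x) (fun x => 1 - sin x)).
        * intros t; auto_derive; auto; ring.
        * rewrite cos_0; ring.
        * intros t _. generalize (SIN_bound t); lra. }
  destruct (Rle_dec 0 y) as [H|H].
  - specialize (Hpos y H). rewrite Rabs_minus_sym, Rabs_pos_eq; lra.
  - specialize (Hpos (- y) ltac:(lra)). rewrite sin_neg in Hpos.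
    rewrite Rabs_pos_eq; [|lra]. replace ((- y) ^ 2) with (y ^ 2) in Hpos by ring. lra.
Qed.

Lemma one_minus_cos_le y : Rabs (cos y - 1) <= y ^ 2 / 2.
Proof.
  assert (H : cos y = 1 - 2 * sin (y / 2) * sin (y / 2)).
  { replace y with (2 * (y / 2)) at 1 by field. apply cos_2a_sin. }
  assert (Hs : Rabs (sin (y / 2)) <= Rabs (y / 2)).
  { assert (Hpos : forall x, 0 <= x -> - x <= sin x <= x).
    { intros x Hx. destruct (Req_dec x 0) as [->|Hn]; [rewrite sin_0; lra|].
      split; [|left; apply sin_lt_x; lra].
      destruct (Rle_dec 1 x); [generalize (SIN_bound x); lra|].
      generalize (sin_ge_0 x Hx) PI2_3_2; lra. }
    destruct (Rle_dec 0 (y / 2)) as [Hy|Hy].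
    - rewrite (Rabs_pos_eq (y / 2)) by lra. apply Rabs_le, Hpos, Hy.
    - rewrite (Rabs_left (y / 2)) by lra. specialize (Hpos (- (y / 2)) ltac:(lra)).
      rewrite sin_neg in Hpos. apply Rabs_le; lra. }
  assert (Hq : sin (y / 2) * sin (y / 2) <= y / 2 * (y / 2)).
  { apply Rsqr_le_abs_1 in Hs. exact Hs. }
  assert (0 <= sin (y / 2) * sin (y / 2)) by (apply Rle_0_sqr).
  rewrite H, Rabs_left1; [|lra]. simpl; lra.
Qed.

(** Applying 1 + y <= exp y at x and at -x encloses exp x - 1 between x and x exp x; both bounds
    follow. *)
Lemma exp_remainder x R0 : Rabs x <= R0 ->
  Rabs (exp x - 1) <= Rabs x * exp R0 /\ Rabs (exp x - 1 - x) <= x ^ 2 * exp R0.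
Proof.
  intros Hx. apply Rabs_le_between in Hx.
  assert (H1 := exp_ineq1_le x). assert (H2 := exp_ineq1_le (- x)).
  assert (H3 : exp x * exp (- x) = 1) by (rewrite <- exp_plus, Rplus_opp_r; apply exp_0).
  assert (H4 : exp x - 1 <= x * exp x) by (generalize (exp_pos x); nra).
  assert (H5 : exp x <= exp R0) by (apply exp_le_compat; lra).
  assert (H6 : 1 <= exp R0) by (rewrite <- exp_0; apply exp_le_compat; lra).
  destruct (Rle_dec 0 x) as [H|H].
  - rewrite !Rabs_pos_eq by lra. split; [nra|]. simpl. nra.
  - assert (exp x - 1 <= 0) by nra.
    rewrite (Rabs_left1 (exp x - 1)), (Rabs_left1 x), (Rabs_pos_eq (exp x - 1 - x)) by lra.
    split; [nra|]. simpl. nra.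
Qed.

(** The two components add up to exp R0 (x^2 + y^2 + |xy|), at most 3/2 exp R0 |u|^2. Quadratic
    estimates of sin y - y and cos y - 1 suffice at this order. *)
Lemma cexp_remainder u R0 : Cmod u <= R0 -> Cmod (cexp u - 1 - u) <= 2 * exp R0 * Cmod u ^ 2.
Proof.
  intros Hu. assert (H1 := Cmod_fst u). assert (H2 := Cmod_sqr u).
  destruct u as [x y]. simpl in H1, H2.
  destruct (exp_remainder x R0 ltac:(lra)) as [E1 E2].
  assert (E3 := sin_minus_id_le y). assert (E4 := one_minus_cos_le y).
  assert (E5 : exp x <= exp R0) by (apply exp_le_compat; apply Rabs_le_between in H1; lra).
  assert (E0 := exp_pos x).
  eapply Rle_trans; [apply Cmod_le_fst_snd|]. unfold cexp; simpl fst; simpl snd.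
  assert (A : Rabs (exp x * cos y + - (1) + - x) <= exp R0 * (y ^ 2 / 2) + x ^ 2 * exp R0).
  { replace (exp x * cos y + - (1) + - x) with (exp x * (cos y - 1) + (exp x - 1 - x)) by ring.
    eapply Rle_trans; [apply Rabs_triang|]. rewrite Rabs_mult, (Rabs_pos_eq (exp x)) by lra.
    apply Rplus_le_compat; [|exact E2]. apply Rmult_le_compat; try lra. apply Rabs_pos. }
  assert (B : Rabs (exp x * sin y + - 0 + - y) <= exp R0 * (y ^ 2 / 2) + Rabs y * (Rabs x * exp R0)).
  { replace (exp x * sin y + - 0 + - y) with (exp x * (sin y - y) + y * (exp x - 1)) by ring.
    eapply Rle_trans; [apply Rabs_triang|]. rewrite !Rabs_mult, (Rabs_pos_eq (exp x)) by lra.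
    apply Rplus_le_compat; (apply Rmult_le_compat; try lra; apply Rabs_pos). }
  replace (Cmod (x, y) ^ 2) with (x * x + y * y) by (simpl; lra).
  assert (Hxy : Rabs y * Rabs x <= (x * x + y * y) / 2).
  { assert (Hx2 : Rabs x * Rabs x = x * x) by (rewrite <- Rabs_mult; apply Rabs_pos_eq, Rle_0_sqr).
    assert (Hy2 : Rabs y * Rabs y = y * y) by (rewrite <- Rabs_mult; apply Rabs_pos_eq, Rle_0_sqr).
    generalize (Rle_0_sqr (Rabs x - Rabs y)); unfold Rsqr; lra. }
  assert (ER : 0 < exp R0) by apply exp_pos.
  apply Rle_trans with (exp R0 * (y * y + x * x + (x * x + y * y) / 2)); [|].
  - eapply Rle_trans; [apply Rplus_le_compat; [exact A|exact B]|].
    replace (exp R0 * (y ^ 2 / 2) + x ^ 2 * exp R0 + (exp R0 * (y ^ 2 / 2) + Rabs y * (Rabs x * exp R0)))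
      with (exp R0 * (y * y + x * x + Rabs y * Rabs x)) by field.
    apply Rmult_le_compat_l; lra.
  - rewrite (Rmult_comm 2), Rmult_assoc. apply Rmult_le_compat_l; [lra|].
    generalize (Rle_0_sqr x) (Rle_0_sqr y); unfold Rsqr; lra.
Qed.

Lemma cexp_quad z w R0 : Cmod z <= R0 -> Cmod w <= R0 ->
  Cmod (cexp z - cexp w - (z - w) * cexp w) <= exp R0 * (2 * exp (2 * R0)) * Cmod (z - w) ^ 2.
Proof.
  intros Hz Hw.
  replace (cexp z) with (cexp w * cexp (z - w))%C by (rewrite <- cexp_plus; f_equal; ring).
  replace (cexp w * cexp (z - w) - cexp w - (z - w) * cexp w)%C
    with (cexp w * (cexp (z - w) - 1 - (z - w)))%C by ring.
  rewrite Cmod_mult, Rmult_assoc. apply Rmult_le_compat; try apply Cmod_ge_0.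
  - now apply Cmod_cexp_le.
  - apply cexp_remainder.
    generalize (Cmod_triangle z (- w)). rewrite Cmod_opp.
    change (z + - w)%C with (z - w)%C. lra.
Qed.

Lemma cexp_lip R0 : 0 <= R0 -> exists K, 0 < K /\ forall z w, Cmod z <= R0 -> Cmod w <= R0 ->
  Cmod (cexp z - cexp w) <= K * Cmod (z - w).
Proof.
  intros HR.
  exists (exp R0 * (2 * exp (2 * R0)) * (2 * R0) + exp R0).
  assert (E1 := exp_pos R0). assert (E2 := exp_pos (2 * R0)).
  assert (E3 : 0 < exp R0 * (2 * exp (2 * R0))) by (apply Rmult_lt_0_compat; lra).
  split; [nra|].
  intros z w Hz Hw. assert (H := cexp_quad z w R0 Hz Hw).
  replace (cexp z - cexp w)%C with ((cexp z - cexp w - (z - w) * cexp w) + (z - w) * cexp w)%C by ring.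
  eapply Rle_trans; [apply Cmod_triangle|]. rewrite (Cmod_mult (z - w)), Rmult_plus_distr_r.
  assert (H0 := Cmod_ge_0 (z - w)).
  assert (Hd : Cmod (z - w) <= 2 * R0).
  { generalize (Cmod_triangle z (- w)). rewrite Cmod_opp.
    change (z + - w)%C with (z - w)%C. lra. }
  set (E := exp R0 * (2 * exp (2 * R0))) in *.
  apply Rplus_le_compat.
  - eapply Rle_trans; [exact H|]. rewrite (Rmult_assoc E). apply Rmult_le_compat_l; [lra|]. simpl. nra.
  - rewrite Rmult_comm. apply Rmult_le_compat_r; [exact H0|]. now apply Cmod_cexp_le.
Qed.

(** The chain rule: the remainder splits into that of [cexp] at [h w] and that of [h] multiplied by
    [cexp (h w)]. *)
Lemma quad_diff_cexp h h' R0 : 0 <= R0 -> (forall z, unit_disc z -> Cmod (h z) <= R0) ->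
  quad_diff_disc h h' -> quad_diff_disc (fun z => cexp (h z)) (fun z => h' z * cexp (h z))%C.
Proof.
  intros HR Hb Hq r Hr. destruct (Hq r Hr) as [M [HM HM']].
  set (E := exp R0 * (2 * exp (2 * R0))).
  assert (E1 := exp_pos R0). assert (E2 := exp_pos (2 * R0)).
  assert (E3 : 0 < E) by (apply Rmult_lt_0_compat; lra).
  (* 3M is a Lipschitz constant of [h] on the subdisc: the linear term contributes M, and |z - w| <=
     2 turns the quadratic remainder into 2M. *)
  exists (E * (3 * M) ^ 2 + M * exp R0).
  assert (P1 : 0 <= E * (3 * M) ^ 2) by (apply Rmult_le_pos; [lra|apply pow2_ge_0]).
  assert (P2 : 0 <= M * exp R0) by (apply Rmult_le_pos; lra).
  split; [lra|]. intros z w Hz Hw.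
  destruct (HM' z w Hz Hw) as [HM1 HM2].
  assert (Hbz : Cmod (h z) <= R0) by (apply Hb; unfold unit_disc; lra).
  assert (Hbw : Cmod (h w) <= R0) by (apply Hb; unfold unit_disc; lra).
  assert (Hew := Cmod_cexp_le _ _ Hbw). assert (H0 := Cmod_ge_0 (z - w)).
  split.
  - assert (Hd : Cmod (z - w) <= 2).
    { generalize (Cmod_triangle z (- w)). rewrite Cmod_opp.
      change (z + - w)%C with (z - w)%C. lra. }
    assert (Hlip : Cmod (h z - h w) <= 3 * M * Cmod (z - w)).
    { replace (h z - h w)%C with ((h z - h w - (z - w) * h' w) + (z - w) * h' w)%C by ring.
      eapply Rle_trans; [apply Cmod_triangle|]. rewrite (Cmod_mult (z - w)).
      assert (M * Cmod (z - w) ^ 2 <= M * (2 * Cmod (z - w))) by (apply Rmult_le_compat_l; simpl; nra).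
      assert (Cmod (z - w) * Cmod (h' w) <= Cmod (z - w) * M) by (apply Rmult_le_compat_l; lra). lra. }
    replace (cexp (h z) - cexp (h w) - (z - w) * (h' w * cexp (h w)))%C with
      ((cexp (h z) - cexp (h w) - (h z - h w) * cexp (h w)) + (h z - h w - (z - w) * h' w) * cexp (h w))%C by ring.
    eapply Rle_trans; [apply Cmod_triangle|]. rewrite (Cmod_mult (h z - h w - (z - w) * h' w)).
    rewrite Rmult_plus_distr_r. apply Rplus_le_compat.
    + eapply Rle_trans; [apply (cexp_quad _ _ R0); assumption|]. fold E.
      rewrite Rmult_assoc. apply Rmult_le_compat_l; [lra|]. rewrite <- Rpow_mult_distr.
      apply pow_incr. split; [apply Cmod_ge_0|exact Hlip].
    + replace (M * exp R0 * Cmod (z - w) ^ 2) with (M * Cmod (z - w) ^ 2 * exp R0) by ring.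
      apply Rmult_le_compat; try apply Cmod_ge_0; assumption.
  - rewrite Cmod_mult. apply Rle_trans with (M * exp R0); [|lra].
    apply Rmult_le_compat; try apply Cmod_ge_0; assumption.
Qed.

Lemma quad_diff_ext g1 g2 g' : (forall z, unit_disc z -> g1 z = g2 z) ->
  quad_diff_disc g1 g' -> quad_diff_disc g2 g'.
Proof.
  intros He Hq r Hr. destruct (Hq r Hr) as [M [HM H]]. exists M. split; [exact HM|].
  intros z w Hz Hw. rewrite <- !He by (unfold unit_disc; lra). now apply H.
Qed.

Lemma is_derive_quad_R (p : R -> R) t d M delta : 0 < delta ->
  (forall s, Rabs (s - t) < delta -> Rabs (p s - p t - (s - t) * d) <= M * (s - t) ^ 2) ->
  is_derive p t d.
Proof.
  intros Hd H. apply is_derive_Reals. intros e He.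
  assert (HM : 0 < Rabs M + 1) by (generalize (Rabs_pos M); lra).
  assert (Hm : 0 < Rmin delta (e / (Rabs M + 1))).
  { apply Rmin_pos; [exact Hd|]. apply Rdiv_lt_0_compat; lra. }
  exists (mkposreal _ Hm). intros x Hx Hxd. simpl in Hxd.
  assert (Hx1 : Rabs x < delta) by (eapply Rlt_le_trans; [exact Hxd|apply Rmin_l]).
  assert (Hx2 : Rabs x < e / (Rabs M + 1)) by (eapply Rlt_le_trans; [exact Hxd|apply Rmin_r]).
  specialize (H (t + x)). replace (t + x - t) with x in H by ring. specialize (H Hx1).
  replace ((p (t + x) - p t) / x - d) with ((p (t + x) - p t - x * d) / x) by (field; exact Hx).
  assert (Hax : 0 < Rabs x) by now apply Rabs_pos_lt.
  unfold Rdiv. rewrite Rabs_mult, Rabs_inv.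
  apply (Rmult_lt_reg_r (Rabs x)); [exact Hax|]. rewrite Rmult_assoc, Rinv_l, Rmult_1_r by lra.
  eapply Rle_lt_trans; [exact H|].
  apply Rle_lt_trans with ((Rabs M + 1) * Rabs x * Rabs x).
  - rewrite <- (pow2_abs x). generalize (Rle_abs M). simpl. intros HA.
    assert (0 <= Rabs x * Rabs x) by nra. nra.
  - apply Rmult_lt_compat_r; [exact Hax|].
    apply (Rmult_lt_compat_l (Rabs M + 1)) in Hx2; [|exact HM].
    replace ((Rabs M + 1) * (e / (Rabs M + 1))) with e in Hx2 by (field; lra). lra.
Qed.

Lemma is_derive_quad_C (p : R -> C) t d M delta : 0 < delta ->
  (forall s, Rabs (s - t) < delta -> Cmod (p s - p t - RtoC (s - t) * d) <= M * (s - t) ^ 2) ->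
  is_derive (fun x => fst (p x)) t (fst d) /\ is_derive (fun x => snd (p x)) t (snd d).
Proof.
  intros Hd H. split; apply (is_derive_quad_R _ _ _ M delta Hd); intros s Hs;
    (eapply Rle_trans; [|apply (H s Hs)]).
  - eapply Rle_trans; [|apply Cmod_fst]. right; simpl. f_equal. ring.
  - eapply Rle_trans; [|apply Cmod_snd]. right; simpl. f_equal. ring.
Qed.

Lemma holder_ccont alpha G (p : R -> C) c t : 0 < alpha -> holder_d (fun _ => True) alpha G ->
  (forall s, Cmod (p s - p t) <= c * Rabs (s - t)) -> ccont_at (fun s => G (p s)) t.
Proof.
  intros Ha [K [HK HH]] Hp. apply ccont_eps. intros e He.
  destruct (Rpower_small alpha K e Ha HK He) as [d [Hd Hde]].
  assert (Hc : 0 < Rabs c + 1) by (generalize (Rabs_pos c); lra).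
  exists (d / (Rabs c + 1)). split; [now apply Rdiv_lt_0_compat|]. intros s Hs.
  eapply Rle_lt_trans; [|exact Hde]. apply HH; auto.
  eapply Rle_trans; [apply Hp|].
  apply Rle_trans with ((Rabs c + 1) * Rabs (s - t)).
  - apply Rmult_le_compat_r; [apply Rabs_pos|]. generalize (Rle_abs c); lra.
  - apply (Rmult_lt_compat_l (Rabs c + 1)) in Hs; [|exact Hc].
    replace ((Rabs c + 1) * (d / (Rabs c + 1))) with d in Hs by (field; lra). lra.
Qed.

(** * Primitives in the disc and univalence *)

(** The integral of [G] along the segment from 0 to z, parametrised over [0, 1]. For [G] continuous
    up to the circle it makes sense at boundary points too. *)
Definition radial_primitive (G : C -> C) (z : C) : C := (z * cint (fun t => G (RtoC t * z)) 0 1)%C.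

Lemma ray_lip (z : C) s t : Cmod (RtoC s * z - RtoC t * z) = Cmod z * Rabs (s - t).
Proof.
  replace (RtoC s * z - RtoC t * z)%C with (RtoC (s - t) * z)%C by (rewrite RtoC_minus; ring).
  rewrite Cmod_mult, Cmod_R. ring.
Qed.

Lemma ray_ccont alpha G z t : 0 < alpha -> holder_d (fun _ => True) alpha G -> ccont_at (fun t => G (RtoC t * z)%C) t.
Proof.
  intros Ha HG. apply (holder_ccont alpha G (fun t => (RtoC t * z)%C) (Cmod z)); auto.
  intros s. rewrite ray_lip. lra.
Qed.

(** Adding the two remainders obtained by exchanging z and w leaves exactly (z - w)(g' z - g' w). *)
Lemma quad_diff_deriv_lip g g' r M :
  (forall z w, Cmod z <= r -> Cmod w <= r -> Cmod (g z - g w - (z - w) * g' w) <= M * Cmod (z - w) ^ 2 /\ Cmod (g' w) <= M) ->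
  forall z w, Cmod z <= r -> Cmod w <= r -> Cmod (g' z - g' w) <= 2 * M * Cmod (z - w).
Proof.
  intros H z w Hz Hw.
  destruct (Req_dec (Cmod (z - w)) 0) as [H0|H0].
  { assert (E : (z - w)%C = RtoC 0) by now apply Cmod_eq_0.
    assert (Ezw : z = w) by (replace z with (z - w + w)%C by ring; rewrite E; ring).
    rewrite Ezw. replace (g' w - g' w)%C with (RtoC 0) by ring.
    replace (w - w)%C with (RtoC 0) by ring. rewrite Cmod_0. lra. }
  assert (Hp := Cmod_ge_0 (z - w)).
  apply (Rmult_le_reg_l (Cmod (z - w))); [lra|].
  rewrite <- Cmod_mult.
  destruct (H z w Hz Hw) as [H1 _]. destruct (H w z Hw Hz) as [H2 _].
  rewrite (Cmod_minus_sym w z) in H2.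
  replace ((z - w) * (g' z - g' w))%C with
    ((g z - g w - (z - w) * g' w) + (g w - g z - (w - z) * g' z))%C by ring.
  eapply Rle_trans; [apply Cmod_triangle|]. simpl in *. lra.
Qed.

Lemma Cmod_RtoC_mult t z : Cmod (RtoC t * z) = Rabs t * Cmod z.
Proof. now rewrite Cmod_mult, Cmod_R. Qed.

Lemma scaled_bound r t z : 0 < r < 1 -> Cmod z <= r -> Rabs t <= 1 + (1 - r) / 2 -> Cmod (RtoC t * z) <= (1 + r) / 2.
Proof.
  intros Hr Hz Ht. rewrite Cmod_RtoC_mult. assert (H0 := Cmod_ge_0 z). assert (H1 := Rabs_pos t).
  apply Rle_trans with ((1 + (1 - r) / 2) * r); [apply Rmult_le_compat; lra|nra].
Qed.

(* The integrand is the derivative of [t -> t * G (t * w)]. *)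
Lemma cint_ray_deriv alpha G G' w : 0 < alpha -> holder_d (fun _ => True) alpha G -> quad_diff_disc G G' ->
  unit_disc w ->
  cex (fun t => RtoC t * w * G' (RtoC t * w))%C 0 1 /\
  cint (fun t => G (RtoC t * w) + RtoC t * w * G' (RtoC t * w))%C 0 1 = G w.
Proof.
  intros Ha HG Hq Hw. unfold unit_disc in Hw.
  set (r := (1 + Cmod w) / 2). assert (H0 := Cmod_ge_0 w).
  assert (Hr : 0 < r < 1) by (unfold r; lra).
  (* The disc is larger than the ray requires: derivatives at t = 1 are two-sided, so points with
     parameter slightly above 1 must stay inside. *)
  destruct (Hq ((1 + r) / 2) ltac:(lra)) as [M [HM HM']].
  assert (Hin : forall t, Rabs t <= 1 + (1 - r) / 2 -> Cmod (RtoC t * w) <= (1 + r) / 2).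
  { intros t Ht. apply scaled_bound; auto. unfold r; lra. }
  assert (Hlip := quad_diff_deriv_lip _ _ _ _ HM').
  set (delta := (1 - r) / 2). assert (Hdelta : 0 < delta) by (unfold delta; lra).
  assert (Hnear : forall s t, 0 <= t <= 1 -> Rabs (s - t) < delta -> Cmod (RtoC s * w) <= (1 + r) / 2 /\ Cmod (RtoC t * w) <= (1 + r) / 2 /\ Rabs s <= 2).
  { intros s t Ht Hs. unfold delta in *.
    assert (Hs1 : Rabs s <= 1 + (1 - r) / 2).
    { replace s with ((s - t) + t) by ring. eapply Rle_trans; [apply Rabs_triang|]. rewrite (Rabs_pos_eq t) by lra. lra. }
    split; [now apply Hin|split; [|lra]]. apply Hin. rewrite Rabs_pos_eq; lra. }
  assert (Hcw : forall t, ccont_at (fun t => RtoC t * w)%C t).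
  { intros t. apply ccont_mult; [apply ccont_id|apply ccont_const]. }
  assert (Hcd : forall t, 0 <= t <= 1 -> ccont_at (fun t => G' (RtoC t * w)%C) t).
  { intros t Ht. apply ccont_eps. intros e He.
    exists (Rmin delta (e / (2 * M + 1))).
    split; [apply Rmin_pos; [exact Hdelta|apply Rdiv_lt_0_compat; lra]|].
    intros s Hs.
    assert (Hs1 : Rabs (s - t) < delta) by (eapply Rlt_le_trans; [exact Hs|apply Rmin_l]).
    assert (Hs2 : Rabs (s - t) < e / (2 * M + 1)) by (eapply Rlt_le_trans; [exact Hs|apply Rmin_r]).
    destruct (Hnear s t Ht Hs1) as [N1 [N2 _]].
    eapply Rle_lt_trans; [apply Hlip; assumption|]. rewrite ray_lip.
    apply (Rmult_lt_compat_l (2 * M + 1)) in Hs2; [|lra].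
    replace ((2 * M + 1) * (e / (2 * M + 1))) with e in Hs2 by (field; lra).
    assert (Hp := Rabs_pos (s - t)). assert (Cmod w * Rabs (s - t) <= 1 * Rabs (s - t)) by (apply Rmult_le_compat_r; lra).
    assert (2 * M * (Cmod w * Rabs (s - t)) <= 2 * M * Rabs (s - t)) by (apply Rmult_le_compat_l; lra).
    lra. }
  assert (Hcd' : forall t, 0 <= t <= 1 -> ccont_at (fun t => RtoC t * w * G' (RtoC t * w))%C t).
  { intros t Ht. apply (ccont_mult (fun t => RtoC t * w)%C); [apply Hcw|now apply Hcd]. }
  split.
  { apply cex_cont. intros t Ht. rewrite Rmin_left, Rmax_right in Ht by lra. now apply Hcd'. }
  rewrite (cint_deriv (fun t => RtoC t * G (RtoC t * w))%C).
  - replace (RtoC 1 * w)%C with w by ring. ring.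
  - intros t Ht. rewrite Rmin_left, Rmax_right in Ht by lra.
    apply (is_derive_quad_C (fun t => RtoC t * G (RtoC t * w))%C t _ (2 * M + M) delta Hdelta).
    intros s Hs. destruct (Hnear s t Ht Hs) as [N1 [N2 N3]].
    destruct (HM' _ _ N1 N2) as [Q1 Q2].
    replace (RtoC s * G (RtoC s * w) - RtoC t * G (RtoC t * w) - RtoC (s - t) * (G (RtoC t * w) + RtoC t * w * G' (RtoC t * w)))%C
      with (RtoC s * (G (RtoC s * w) - G (RtoC t * w) - (RtoC s * w - RtoC t * w) * G' (RtoC t * w))
            + RtoC (s - t) * RtoC (s - t) * w * G' (RtoC t * w))%C by (rewrite RtoC_minus; ring).
    eapply Rle_trans; [apply Cmod_triangle|]. rewrite !Cmod_mult, !Cmod_R.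
    rewrite ray_lip in Q1.
    assert (Hsq : Rabs (s - t) * Rabs (s - t) = (s - t) ^ 2) by (rewrite <- Rabs_mult, Rabs_pos_eq; [ring|apply Rle_0_sqr]).
    assert (Hsq0 := pow2_ge_0 (s - t)).
    rewrite Rmult_plus_distr_r. apply Rplus_le_compat.
    + rewrite (Rmult_assoc 2). apply Rmult_le_compat; [apply Rabs_pos|apply Cmod_ge_0|exact N3|].
      eapply Rle_trans; [exact Q1|]. apply Rmult_le_compat_l; [exact HM|].
      replace ((Cmod w * Rabs (s - t)) ^ 2) with (Cmod w * Cmod w * (Rabs (s - t) * Rabs (s - t))) by ring.
      rewrite Hsq. rewrite <- (Rmult_1_l ((s - t) ^ 2)) at 2. apply Rmult_le_compat_r; [exact Hsq0|nra].
    + rewrite Hsq. rewrite (Rmult_comm M), Rmult_assoc. apply Rmult_le_compat_l; [exact Hsq0|].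
      rewrite <- (Rmult_1_l M). apply Rmult_le_compat; try apply Cmod_ge_0; lra.
  - intros t Ht. rewrite Rmin_left, Rmax_right in Ht by lra.
    apply (ccont_plus (fun t => G (RtoC t * w)%C)); [now apply (ray_ccont alpha)|now apply Hcd'].
Qed.

(** Writing G w as the integral from [cint_ray_deriv] brings everything under one integral sign. The
    integrand is z times the remainder of [G] between tz and tw, plus t (z - w)^2 G'(tw); each term
    is at most M |z - w|^2. *)
Lemma radial_primitive_quad alpha G G' r : 0 < alpha -> holder_d (fun _ => True) alpha G -> quad_diff_disc G G' ->
  0 < r < 1 ->
  exists M, 0 <= M /\ forall z w, Cmod z <= r -> Cmod w <= r ->
    Cmod (radial_primitive G z - radial_primitive G w - (z - w) * G w) <= M * Cmod (z - w) ^ 2.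
Proof.
  intros Ha HG Hq Hr. destruct (Hq r Hr) as [M [HM HM']].
  exists (2 * M). split; [lra|]. intros z w Hz Hw.
  destruct (cint_ray_deriv alpha G G' w Ha HG Hq) as [Hex Hint]; [unfold unit_disc; lra|].
  assert (Hez : cex (fun t => G (RtoC t * z)%C) 0 1) by (apply cex_cont_all; intros; now apply (ray_ccont alpha)).
  assert (Hew : cex (fun t => G (RtoC t * w)%C) 0 1) by (apply cex_cont_all; intros; now apply (ray_ccont alpha)).
  assert (Hsum := cex_plus _ _ _ _ Hew Hex).
  assert (Hm : forall f g, cex f 0 1 -> cex g 0 1 -> cex (fun t => f t - g t)%C 0 1).
  { intros f g [F1 F2] [G1 G2]; split; [exact (ex_RInt_minus _ _ _ _ F1 G1)|exact (ex_RInt_minus _ _ _ _ F2 G2)]. }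
  rewrite <- Hint at 1. unfold radial_primitive.
  assert (Sz := cex_scal z _ _ _ Hez). assert (Sw := cex_scal w _ _ _ Hew).
  assert (Ss := cex_scal (z - w) _ _ _ Hsum). assert (Szw := Hm _ _ Sz Sw).
  rewrite <- (cint_scal z _ _ _ Hez), <- (cint_scal w _ _ _ Hew), <- (cint_scal (z - w) _ _ _ Hsum).
  rewrite <- (cint_minus _ _ _ _ Sz Sw), <- (cint_minus _ _ _ _ Szw Ss).
  replace (2 * M * Cmod (z - w) ^ 2) with ((1 - 0) * (2 * M * Cmod (z - w) ^ 2)) by ring.
  apply cint_norm_le_const; [lra|exact (Hm _ _ Szw Ss)|].
  intros t Ht.
  assert (Hsc : forall x, Cmod x <= r -> Cmod (RtoC t * x) <= r).
  { intros x Hx. rewrite Cmod_RtoC_mult, Rabs_pos_eq by lra. generalize (Cmod_ge_0 x); nra. }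
  destruct (HM' _ _ (Hsc z Hz) (Hsc w Hw)) as [Q1 Q2].
  replace (z * G (RtoC t * z) - w * G (RtoC t * w) - (z - w) * (G (RtoC t * w) + RtoC t * w * G' (RtoC t * w)))%C
    with (z * (G (RtoC t * z) - G (RtoC t * w) - (RtoC t * z - RtoC t * w) * G' (RtoC t * w))
          + RtoC t * ((z - w) * (z - w)) * G' (RtoC t * w))%C by ring.
  eapply Rle_trans; [apply Cmod_triangle|]. rewrite !Cmod_mult, Cmod_R, Rabs_pos_eq by lra.
  replace (RtoC t * z - RtoC t * w)%C with (RtoC t * (z - w))%C in Q1 by ring.
  rewrite Cmod_RtoC_mult, Rabs_pos_eq in Q1 by lra.
  replace (RtoC t * z - RtoC t * w)%C with (RtoC t * (z - w))%C by ring.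
  set (m := Cmod (z - w)) in *. assert (H0 : 0 <= m) by apply Cmod_ge_0.
  assert (Hmm : 0 <= m * m) by nra.
  assert (A : M * (t * m) ^ 2 <= M * (m * m)).
  { apply Rmult_le_compat_l; [exact HM|]. replace ((t * m) ^ 2) with (t * t * (m * m)) by ring.
    rewrite <- (Rmult_1_l (m * m)) at 2. apply Rmult_le_compat_r; nra. }
  set (q := Cmod (G (RtoC t * z) - G (RtoC t * w) - RtoC t * (z - w) * G' (RtoC t * w))%C) in *.
  assert (B : Cmod z * q <= 1 * (M * (m * m))).
  { apply Rmult_le_compat; try apply Cmod_ge_0; lra. }
  assert (D : t * (m * m) * Cmod (G' (RtoC t * w)%C) <= 1 * (m * m) * M).
  { apply Rmult_le_compat; [nra|apply Cmod_ge_0|apply Rmult_le_compat_r; lra|exact Q2]. }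
  simpl. lra.
Qed.

Lemma radial_primitive_modulus alpha G B : 0 < alpha -> holder_d (fun _ => True) alpha G -> (forall z, Cmod (G z) <= B) ->
  exists K, 0 < K /\ forall z w d, Cmod w <= 1 -> 0 < d -> Cmod (z - w) <= d ->
    Cmod (radial_primitive G z - radial_primitive G w) <= d * B + K * Rpower d alpha.
Proof.
  intros Ha HG HB. assert (HG' := HG). destruct HG' as [K [HK HH]]. exists K. split; [exact HK|].
  intros z w d Hw Hd Hzw. unfold radial_primitive.
  assert (Hez : cex (fun t => G (RtoC t * z)%C) 0 1) by (apply cex_cont_all; intros; now apply (ray_ccont alpha)).
  assert (Hew : cex (fun t => G (RtoC t * w)%C) 0 1) by (apply cex_cont_all; intros; now apply (ray_ccont alpha)).
  match goal with |- Cmod (z * ?x - w * ?y) <= _ =>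
    replace (z * x - w * y)%C with ((z - w) * x + w * (x - y))%C by ring end.
  eapply Rle_trans; [apply Cmod_triangle|]. rewrite !Cmod_mult. apply Rplus_le_compat.
  - apply Rmult_le_compat; try apply Cmod_ge_0; [exact Hzw|].
    replace B with ((1 - 0) * B) by ring. apply cint_norm_le_const; auto; lra.
  - rewrite <- cint_minus by assumption.
    rewrite <- (Rmult_1_l (K * Rpower d alpha)). apply Rmult_le_compat; try apply Cmod_ge_0; [exact Hw|].
    replace (K * Rpower d alpha) with ((1 - 0) * (K * Rpower d alpha)) by ring.
    apply cint_norm_le_const; [lra| |].
    + apply cex_cont_all; intros; apply ccont_minus; now apply (ray_ccont alpha).
    + intros t Ht. apply HH; auto.
      replace (RtoC t * z - RtoC t * w)%C with (RtoC t * (z - w))%C by ring.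
      rewrite Cmod_RtoC_mult, Rabs_pos_eq by lra. generalize (Cmod_ge_0 (z - w)); nra.
Qed.

Lemma RInt_ge_const f c : ex_RInt f 0 1 -> (forall t, c <= f t) -> c <= RInt f 0 1.
Proof.
  intros Hf Hc. assert (H : RInt (fun _ => c) 0 1 = c) by (rewrite RInt_const; unfold scal; simpl; unfold mult; simpl; ring).
  rewrite <- H. apply RInt_le; auto; [lra|apply ex_RInt_const].
Qed.

(** Quantitative Noshiro-Warschawski. The disc is convex, so the increment is z - w times the mean
    of [G] over the segment, and the real part of that mean is at least c. *)
Lemma radial_primitive_expanding alpha G G' c : 0 < alpha -> holder_d (fun _ => True) alpha G -> quad_diff_disc G G' ->
  (forall z, c <= fst (G z)) -> 0 < c ->
  forall z w, unit_disc z -> unit_disc w -> c * Cmod (z - w) <= Cmod (radial_primitive G z - radial_primitive G w).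
Proof.
  intros Ha HG Hq Hc Hc0 z w Hz Hw. unfold unit_disc in *.
  set (r := Rmax (1 / 2) (Rmax (Cmod z) (Cmod w))).
  assert (Hr : 0 < r < 1 /\ Cmod z <= r /\ Cmod w <= r).
  { unfold r, Rmax; repeat destruct (Rle_dec _ _); lra. }
  destruct Hr as [Hr [Hzr Hwr]].
  destruct (radial_primitive_quad alpha G G' ((1 + r) / 2) Ha HG Hq ltac:(lra)) as [M [HM HM']].
  set (p := fun t => (w + RtoC t * (z - w))%C).
  assert (Hp : forall s t, (p s - p t)%C = (RtoC (s - t) * (z - w))%C).
  { intros s t. unfold p. rewrite RtoC_minus. ring. }
  assert (Hpc : forall t, ccont_at (fun t => G (p t)) t).
  { intros t. apply (holder_ccont alpha G p (Cmod (z - w))); auto.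
    intros s. rewrite Hp, Cmod_RtoC_mult. right; ring. }
  assert (Hpr : forall t, 0 <= t <= 1 -> Cmod (p t) <= r).
  { intros t Ht. replace (p t) with (RtoC (1 - t) * w + RtoC t * z)%C by (unfold p; rewrite RtoC_minus; ring).
    eapply Rle_trans; [apply Cmod_triangle|]. rewrite !Cmod_RtoC_mult, !Rabs_pos_eq by lra. nra. }
  assert (Hd2 : Cmod (z - w) <= 2).
  { generalize (Cmod_triangle z (- w)). rewrite Cmod_opp. change (z + - w)%C with (z - w)%C. lra. }
  (* Since |z - w| <= 2, a parameter step below delta moves the point by at most (1 - r)/2, which
     stays in the disc of radius (1 + r)/2. *)
  set (delta := (1 - r) / 4). assert (Hdelta : 0 < delta) by (unfold delta; lra).
  assert (E : cint (fun t => (z - w) * G (p t))%C 0 1 = (radial_primitive G z - radial_primitive G w)%C).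
  { rewrite (cint_deriv (fun t => radial_primitive G (p t))).
    - f_equal; [|f_equal]; f_equal; unfold p; ring.
    - intros t Ht. rewrite Rmin_left, Rmax_right in Ht by lra.
      apply (is_derive_quad_C (fun t => radial_primitive G (p t)) t _ (M * 4) delta Hdelta).
      intros s Hs.
      assert (Hpt := Hpr t Ht).
      assert (Hps : Cmod (p s) <= (1 + r) / 2).
      { eapply Rle_trans; [apply (Cmod_le_plus_minus _ (p t))|]. rewrite Hp, Cmod_RtoC_mult.
        assert (Rabs (s - t) * Cmod (z - w) <= delta * 2) by (apply Rmult_le_compat; [apply Rabs_pos|apply Cmod_ge_0|lra|lra]).
        unfold delta in *. lra. }
      assert (Q := HM' (p s) (p t) Hps ltac:(lra)). rewrite Hp in Q.
      rewrite Cmult_assoc. eapply Rle_trans; [exact Q|]. rewrite Cmod_RtoC_mult.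
      rewrite Rmult_assoc. apply Rmult_le_compat_l; [exact HM|].
      rewrite Rpow_mult_distr, pow2_abs, Rmult_comm. apply Rmult_le_compat_r; [apply pow2_ge_0|].
      generalize (Cmod_ge_0 (z - w)); simpl; nra.
    - intros t _. apply ccont_mult; [apply ccont_const|apply Hpc]. }
  rewrite <- E, cint_scal by (now apply cex_cont_all). rewrite Cmod_mult, Rmult_comm.
  apply Rmult_le_compat_l; [apply Cmod_ge_0|].
  eapply Rle_trans; [|eapply Rle_trans; [apply Rle_abs|apply Cmod_fst]].
  apply (RInt_ge_const (fun t => fst (G (p t)))); auto.
  apply ex_RInt_cont; intros t; exact (proj1 (Hpc t)).
Qed.

(** The constant c is uniform, so the inequality survives the radial limit; mere injectivity would
    not. This excludes self-contact of the image of the circle. *)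
Lemma radial_primitive_expanding_closed alpha G G' c B : 0 < alpha -> holder_d (fun _ => True) alpha G -> quad_diff_disc G G' ->
  (forall z, Cmod (G z) <= B) ->
  (forall z, c <= fst (G z)) -> 0 < c ->
  forall z w, closed_unit_disc z -> closed_unit_disc w -> c * Cmod (z - w) <= Cmod (radial_primitive G z - radial_primitive G w).
Proof.
  intros Ha HG Hq HB Hc Hc0 z w Hz Hw. unfold closed_unit_disc in *.
  destruct (radial_primitive_modulus alpha G B Ha HG HB) as [K [HK HKm]].
  assert (HB0 : 0 <= B) by (eapply Rle_trans; [apply Cmod_ge_0|apply (HB (RtoC 0))]).
  assert (Hlim : forall x, Cmod x <= 1 -> clim (fun n => radial_primitive G (approx n x)) (radial_primitive G x)).
  { intros x Hx. apply clim_eps. intros e He.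
    destruct (Rpower_small alpha K (e / 2) Ha HK ltac:(lra)) as [d [Hd Hde]].
    set (d' := Rmin d (e / (2 * (B + 1)))).
    assert (Hd' : 0 < d') by (apply Rmin_pos; [exact Hd|apply Rdiv_lt_0_compat; lra]).
    destruct (radius_close d' Hd') as [N HN]. exists N. intros n Hn.
    assert (Hc1 : Cmod (approx n x - x) <= d').
    { rewrite <- (disc_proj_id x Hx) at 2. generalize (approx_close n x) (HN n Hn); lra. }
    eapply Rle_lt_trans; [apply (HKm _ _ d'); assumption|].
    assert (H1 : Rpower d' alpha <= Rpower d alpha) by (apply Rle_Rpower_l; [lra|]; split; [exact Hd'|apply Rmin_l]).
    assert (H2 : d' * B <= e / (2 * (B + 1)) * (B + 1)) by (apply Rmult_le_compat; try lra; apply Rmin_r).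
    replace (e / (2 * (B + 1)) * (B + 1)) with (e / 2) in H2 by (field; lra).
    assert (K * Rpower d' alpha <= K * Rpower d alpha) by (apply Rmult_le_compat_l; lra). lra. }
  assert (Hrad : is_lim_seq radius 1).
  { apply is_lim_seq_spec. intros e. destruct (radius_close e (cond_pos e)) as [N HN]. exists N. intros n Hn.
    generalize (HN n Hn) (radius_bounds n). intros. rewrite Rabs_left; lra. }
  assert (L1 := Hlim z Hz). assert (L2 := Hlim w Hw).
  assert (Hsum : is_lim_seq (fun n => radius n * (c * Cmod (z - w)) +
     (- Cmod (radial_primitive G (approx n z) - radial_primitive G z) + - Cmod (radial_primitive G (approx n w) - radial_primitive G w)))
     (1 * (c * Cmod (z - w)) + (- 0 + - 0))).
  { apply is_lim_seq_plus'; [apply is_lim_seq_mult'; [exact Hrad|apply is_lim_seq_const]|].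
    apply is_lim_seq_plus'; apply (is_lim_seq_opp _ 0); assumption. }
  assert (E : Rbar_le (1 * (c * Cmod (z - w)) + (- 0 + - 0)) (Cmod (radial_primitive G z - radial_primitive G w))).
  { refine (is_lim_seq_le _ (fun _ => Cmod (radial_primitive G z - radial_primitive G w)) _ _ _ Hsum (is_lim_seq_const _)).
    intros n.
    assert (H := radial_primitive_expanding alpha G G' c Ha HG Hq Hc Hc0 _ _ (approx_in_disc n z) (approx_in_disc n w)).
    assert (Hr := radius_bounds n).
    replace (Cmod (approx n z - approx n w)) with (radius n * Cmod (z - w)) in H.
    2:{ unfold approx. rewrite !disc_proj_id by assumption.
        replace (RtoC (radius n) * z - RtoC (radius n) * w)%C with (RtoC (radius n) * (z - w))%C by ring.
        rewrite Cmod_RtoC_mult, Rabs_pos_eq; lra. }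
    assert (T1 := Cmod_minus_triangle (radial_primitive G (approx n z)) (radial_primitive G z) (radial_primitive G (approx n w))).
    assert (T2 := Cmod_minus_triangle (radial_primitive G z) (radial_primitive G w) (radial_primitive G (approx n w))).
    rewrite (Cmod_minus_sym (radial_primitive G w)) in T2. lra. }
  simpl in E. lra.
Qed.

(** * From explicit estimates to complex differentiability and continuity *)

Lemma is_derive_C_quad (f : C -> C) z l M delta : 0 < delta ->
  (forall w, Cmod (w - z) < delta -> Cmod (f w - f z - (w - z) * l) <= M * Cmod (w - z) ^ 2) ->
  is_derive (K := C_AbsRing) (V := C_NormedModule) f z l.
Proof.
  intros Hd H. split; [apply is_linear_scal_l|].
  intros x Hx. assert (E : z = x) by exact (is_filter_lim_locally_unique (K := C_AbsRing) (V := AbsRing_NormedModule C_AbsRing) z x Hx).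
  rewrite <- E. clear x Hx E.
  intros eps.
  assert (HM : 0 < Rabs M + 1) by (generalize (Rabs_pos M); lra).
  assert (Hm : 0 < Rmin delta (eps / (Rabs M + 1))).
  { apply Rmin_pos; [exact Hd|]. apply Rdiv_lt_0_compat; [apply cond_pos|lra]. }
  apply (locally_le_locally_norm (V := AbsRing_NormedModule C_AbsRing)).
  exists (mkposreal _ Hm). intros w Hw.
  change (Cmod (w - z) < Rmin delta (eps / (Rabs M + 1))) in Hw.
  change (Cmod (f w - f z - (w - z) * l) <= eps * Cmod (w - z)).
  assert (Hw1 : Cmod (w - z) < delta) by (eapply Rlt_le_trans; [exact Hw|apply Rmin_l]).
  assert (Hw2 : Cmod (w - z) < eps / (Rabs M + 1)) by (eapply Rlt_le_trans; [exact Hw|apply Rmin_r]).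
  eapply Rle_trans; [now apply H|].
  apply (Rmult_lt_compat_l (Rabs M + 1)) in Hw2; [|exact HM].
  replace ((Rabs M + 1) * (eps / (Rabs M + 1))) with (pos eps) in Hw2 by (field; lra).
  assert (H0 := Cmod_ge_0 (w - z)). set (m := Cmod (w - z)) in *.
  replace (M * m ^ 2) with (M * m * m) by ring. apply Rmult_le_compat_r; [exact H0|].
  assert (M * m <= Rabs M * m) by (apply Rmult_le_compat_r; [exact H0|apply Rle_abs]). lra.
Qed.

Lemma continuous_C_eps (f : C -> C) z :
  (forall e, 0 < e -> exists d, 0 < d /\ forall w, Cmod (w - z) < d -> Cmod (f w - f z) < e) ->
  continuous (T := C_UniformSpace) (U := C_UniformSpace) f z.
Proof.
  intros H P [e He]. destruct (H e (cond_pos e)) as [d [Hd Hd']].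
  (* Neighbourhoods in the product structure are squares; the square of half-side d/2 lies in the
     disc of radius d. *)
  assert (Hd2 : 0 < d / 2) by lra.
  exists (mkposreal _ Hd2). intros w [Hw1 Hw2]. apply He.
  change (Rabs (fst w - fst z) < d / 2) in Hw1. change (Rabs (snd w - snd z) < d / 2) in Hw2.
  assert (Hw : Cmod (w - z) < d).
  { eapply Rle_lt_trans; [apply Cmod_le_fst_snd|].
    change (Rabs (fst w - fst z) + Rabs (snd w - snd z) < d). lra. }
  specialize (Hd' w Hw). split.
  - exact (Rle_lt_trans _ _ _ (Cmod_fst (f w - f z)) Hd').
  - exact (Rle_lt_trans _ _ _ (Cmod_snd (f w - f z)) Hd').
Qed.

(** * From [phi] to the boundary values of [ln |f'|] *)

Lemma periodic_INR (g : R -> R) L n s : (forall s, g (s + L) = g s) -> g (s + INR n * L) = g s.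
Proof.
  intros H. revert s; induction n as [|n IH]; intros s.
  - f_equal; simpl; ring.
  - rewrite S_INR. replace (s + (INR n + 1) * L) with (s + INR n * L + L) by ring. rewrite H. apply IH.
Qed.

Lemma periodic_reduce (g : R -> R) L : 0 < L -> (forall s, g (s + L) = g s) ->
  forall s, exists s', 0 <= s' <= L /\ g s = g s'.
Proof.
  intros HL H.
  assert (Hpos : forall s, 0 <= s -> exists s', 0 <= s' <= L /\ g s = g s').
  { intros s Hs. destruct (nfloor_ex (s / L)) as [n [Hn1 Hn2]].
    { apply Rmult_le_pos; [exact Hs|left; now apply Rinv_0_lt_compat]. }
    assert (E : s = s / L * L) by (field; lra).
    assert (B1 := Rmult_le_compat_r L _ _ (Rlt_le _ _ HL) Hn1).
    assert (B2 := Rmult_lt_compat_r L _ _ HL Hn2).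
    exists (s - INR n * L). split; [lra|].
    rewrite <- (periodic_INR g L n (s - INR n * L) H). f_equal; ring. }
  intros s. destruct (Rle_dec 0 s) as [Hs|Hs]; [now apply Hpos|].
  destruct (nfloor_ex (- s / L)) as [n [Hn1 Hn2]].
  { apply Rmult_le_pos; [lra|left; now apply Rinv_0_lt_compat]. }
  assert (E : - s = - s / L * L) by (field; lra).
  assert (B2 := Rmult_lt_compat_r L _ _ HL Hn2).
  rewrite <- (periodic_INR g L (S n) s H). apply Hpos. rewrite S_INR. lra.
Qed.

Lemma MVT_derive (f df : R -> R) a b : (forall x, is_derive f x (df x)) ->
  exists c, f b - f a = df c * (b - a).
Proof.
  intros H. destruct (MVT_gen f a b df) as [c [_ E]].
  - intros; apply H.
  - intros x _. apply continuity_pt_filterlim, (ex_derive_continuous (V := R_NormedModule)). exists (df x); apply H.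
  - now exists c.
Qed.

(** [sigma] inverts theta = Phi(s), so exp(rho) is ds/dtheta and its primitive is [sigma]. The
    Lipschitz estimate is made in the variable s, as |ln phi(a) - ln phi(b)| <= |Phi(a) - Phi(b)|,
    which avoids differentiating the inverse function. *)
Lemma boundary_speed L phi : 0 < L -> C1_on_R phi -> (forall s, phi (s + L) = phi s) ->
  (forall s, 0 < phi s) -> RInt phi 0 L = 1 ->
  (forall s, 0 <= s <= L -> Rabs (Derive phi s / phi s ^ 2) <= 2 * PI) ->
  exists rho sigma : R -> R, lip_periodic rho /\
    (forall th, exp (rho th) = 1 / (2 * PI * phi (sigma th))) /\
    (forall th, RInt (fun t => exp (rho t)) 0 th = sigma th) /\
    sigma (2 * PI) = L.
Proof.
  intros HL HC1 Hper Hpos Hint Hmax. assert (HPI := PI_RGT_0).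
  assert (Hd : forall s, is_derive phi s (Derive phi s)) by (intros s; apply Derive_correct, HC1).
  assert (Hc : forall s, continuous phi s) by (intros s; apply (ex_derive_continuous (V := R_NormedModule)), HC1).
  assert (Hex : forall a b, ex_RInt phi a b) by (intros; now apply ex_RInt_cont).
  set (Phi := fun s => 2 * PI * RInt phi 0 s).
  assert (HPhi : forall s, is_derive Phi s (2 * PI * phi s)).
  { intros s. unfold Phi. apply (is_derive_scal (fun s => RInt phi 0 s)).
    apply (is_derive_RInt phi (fun s => RInt phi 0 s) 0).
    - exists (mkposreal 1 Rlt_0_1). intros y _. apply (RInt_correct (V := R_CompleteNormedModule)), Hex.
    - apply Hc. }
  assert (HPhi0 : Phi 0 = 0) by (unfold Phi; rewrite RInt_point; apply Rmult_0_r).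
  assert (HPhiL : forall s, Phi (s + L) = Phi s + 2 * PI).
  (* By periodicity of [phi] the difference Phi(s + L) - Phi(s) has zero derivative; at s = 0 it
     equals 2 pi times the unit integral. *)
  { intros s. destruct (MVT_derive (fun s => Phi (s + L) - Phi s) (fun s => 2 * PI * phi (s + L) - 2 * PI * phi s) 0 s) as [c Hcc].
    - intros x. apply (is_derive_minus (V := R_NormedModule) (fun s => Phi (s + L)) Phi); [|apply HPhi].
      rewrite <- (Rmult_1_l (2 * PI * phi (x + L))).
      apply (is_derive_comp Phi (fun s => s + L)); [apply HPhi|]. auto_derive; auto.
    - rewrite Hper in Hcc. rewrite Rplus_0_l, HPhi0 in Hcc.
      assert (HPL : Phi L = 2 * PI) by (unfold Phi; rewrite Hint; ring). lra. }
  assert (Hmono : forall a b, a < b -> Phi a < Phi b).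
  { intros a b Hab. destruct (MVT_derive Phi _ a b HPhi) as [c E]. specialize (Hpos c).
    assert (0 < 2 * PI * phi c * (b - a)) by (apply Rmult_lt_0_compat; [apply Rmult_lt_0_compat; lra|lra]). lra. }
  assert (Hinj : forall a b, Phi a = Phi b -> a = b).
  { intros a b E. destruct (Rtotal_order a b) as [H|[H|H]]; [|exact H|]; apply Hmono in H; lra. }
  assert (HPhin : forall n, Phi (INR n * L) = 2 * PI * INR n /\ Phi (- (INR n * L)) = - (2 * PI * INR n)).
  { induction n as [|n [IH1 IH2]].
    - simpl. rewrite Rmult_0_l, Ropp_0, HPhi0. split; ring.
    - rewrite S_INR. split.
      + replace ((INR n + 1) * L) with (INR n * L + L) by ring. rewrite HPhiL. lra.
      + assert (E := HPhiL (- ((INR n + 1) * L))).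
        replace (- ((INR n + 1) * L) + L) with (- (INR n * L)) in E by ring. lra. }
  (* The sigma type lets the inverse be defined by projection. The bracket for the intermediate
     value theorem is s = -(n+1)L and s = (n+1)L, where [Phi] equals -2 pi (n+1) and 2 pi (n+1). *)
  assert (Hsurj : forall th, { s | Phi s = th }).
  { intros th. destruct (nfloor_ex (Rabs th) (Rabs_pos th)) as [n [Hn1 Hn2]].
    destruct (HPhin (S n)) as [E1 E2].
    assert (HB : Rabs th <= 2 * PI * INR (S n)).
    { rewrite S_INR. assert (P3 := PI2_3_2). assert (0 <= INR n) by apply pos_INR. nra. }
    apply Rabs_le_between in HB.
    destruct (IVT_gen Phi (- (INR (S n) * L)) (INR (S n) * L) th) as [s [_ Hs]].
    - intros x. apply continuity_pt_filterlim, (ex_derive_continuous (V := R_NormedModule)). eexists; apply HPhi.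
    - rewrite E1, E2. split; [eapply Rle_trans; [apply Rmin_l|]|eapply Rle_trans; [|apply Rmax_r]]; lra.
    - now exists s. }
  set (sigma := fun th => proj1_sig (Hsurj th)).
  assert (Hsig : forall th, Phi (sigma th) = th) by (intros th; exact (proj2_sig (Hsurj th))).
  set (rho := fun th => - ln (2 * PI * phi (sigma th))).
  assert (Hpp : forall s, 0 < 2 * PI * phi s) by (intros s; apply Rmult_lt_0_compat; [lra|apply Hpos]).
  assert (Hexp : forall th, exp (rho th) = / (2 * PI * phi (sigma th))).
  { intros th. unfold rho. rewrite exp_Ropp, exp_ln by apply Hpp. reflexivity. }
  assert (Hperd : forall s, Derive phi (s + L) = Derive phi s).
  { intros s. apply eq_sym, is_derive_unique.
    apply (is_derive_ext (fun s => phi (s + L))); [exact Hper|].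
    rewrite <- (Rmult_1_l (Derive phi (s + L))).
    apply (is_derive_comp phi (fun s => s + L)); [apply Hd|]. auto_derive; auto. }
  assert (Hmax' : forall s, Rabs (Derive phi s) <= 2 * PI * phi s ^ 2).
  { intros s.
    destruct (periodic_reduce (fun s => Rabs (Derive phi s / phi s ^ 2)) L HL) with (s := s) as [s' [Hs' E]].
    - intros x. now rewrite Hperd, Hper.
    - specialize (Hmax s' Hs'). rewrite <- E in Hmax.
      assert (Hp2 : 0 < phi s ^ 2) by apply pow_lt, Hpos.
      unfold Rdiv in Hmax. rewrite Rabs_mult, Rabs_inv, (Rabs_pos_eq (phi s ^ 2)) in Hmax by lra.
      apply (Rmult_le_compat_r (phi s ^ 2)) in Hmax; [|lra].
      rewrite Rmult_assoc, Rinv_l, Rmult_1_r in Hmax by lra. exact Hmax. }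
  (* [Phi + ln phi] and [Phi - ln phi] are nondecreasing. *)
  assert (Hln : forall a b, Rabs (ln (2 * PI * phi a) - ln (2 * PI * phi b)) <= Rabs (Phi a - Phi b)).
  { assert (Hlt : forall e a b, e = 1 \/ e = -1 -> a <= b ->
      e * (ln (2 * PI * phi b) - ln (2 * PI * phi a)) <= Phi b - Phi a).
    { intros e a b He Hab.
      destruct (MVT_derive (fun s => Phi s - e * ln (2 * PI * phi s)) (fun s => 2 * PI * phi s - e * (Derive phi s / phi s)) a b) as [c E].
      - intros x. apply (is_derive_minus (V := R_NormedModule) Phi); [apply HPhi|].
        apply (is_derive_scal (fun s => ln (2 * PI * phi s))).
        auto_derive; [split; [eexists; apply Hd|split; [apply Hpp|auto]]|].
        change (Derive (fun x => phi x) x) with (Derive phi x). field. split; [generalize (Hpos x)|]; lra.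
      - assert (0 <= 2 * PI * phi c - e * (Derive phi c / phi c)).
        { assert (B := Hmax' c). assert (P := Hpos c). apply Rabs_le_between in B.
          apply (Rmult_le_reg_r (phi c)); [exact P|].
          replace ((2 * PI * phi c - e * (Derive phi c / phi c)) * phi c) with (2 * PI * phi c ^ 2 - e * Derive phi c) by (field; lra).
          destruct He as [-> | ->]; lra. }
        assert (0 <= (2 * PI * phi c - e * (Derive phi c / phi c)) * (b - a)) by (apply Rmult_le_pos; lra).
        lra. }
    intros a b. destruct (Rle_dec a b) as [H|H].
    - assert (A := Hlt 1 a b ltac:(auto) H). assert (B := Hlt (-1) a b ltac:(auto) H).
      rewrite (Rabs_minus_sym (Phi a)), (Rabs_pos_eq (Phi b - Phi a)); [apply Rabs_le; lra|lra].
    - assert (A := Hlt 1 b a ltac:(auto) ltac:(lra)). assert (B := Hlt (-1) b a ltac:(auto) ltac:(lra)).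
      rewrite (Rabs_pos_eq (Phi a - Phi b)); [apply Rabs_le; lra|lra]. }
  assert (Hlip : forall s t, Rabs (rho s - rho t) <= Rabs (s - t)).
  { intros s t. unfold rho. replace (- ln (2 * PI * phi (sigma s)) - - ln (2 * PI * phi (sigma t)))
      with (ln (2 * PI * phi (sigma t)) - ln (2 * PI * phi (sigma s))) by ring.
    rewrite (Rabs_minus_sym s). rewrite <- (Hsig s) at 2. rewrite <- (Hsig t) at 2. apply Hln. }
  exists rho, sigma. split; [split; [exact Hlip|]|split; [|split]].
  - intros t. unfold rho. do 3 f_equal.
    replace (sigma (t + 2 * PI)) with (sigma t + L); [apply Hper|].
    apply Hinj. rewrite HPhiL, !Hsig. reflexivity.
  - intros th. rewrite Hexp. unfold Rdiv. ring.
  - intros th.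
    (* After the substitution t = Phi(s) the integrand is 2 pi phi(s) / (2 pi phi(s)) = 1. *)
    assert (E := RInt_comp (V := R_CompleteNormedModule) (fun t => exp (rho t)) Phi (fun s => 2 * PI * phi s) 0 (sigma th)).
    rewrite HPhi0, Hsig in E. rewrite <- E.
    + transitivity (RInt (fun _ => 1) 0 (sigma th)).
      * apply RInt_ext. intros x _.
        replace (sigma (Phi x)) with x by (apply Hinj; now rewrite Hsig).
        change (2 * PI * phi x * exp (rho (Phi x)) = 1). rewrite Hexp.
        replace (sigma (Phi x)) with x by (apply Hinj; now rewrite Hsig).
        apply Rinv_r. generalize (Hpp x); lra.
      * rewrite RInt_const. change ((sigma th - 0) * 1 = sigma th). ring.
    + intros x _. apply (continuous_comp rho exp); [now apply lip_continuous|apply continuous_exp].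
    + intros x _. split; [apply HPhi|]. apply (continuous_scal_r (V := R_NormedModule) (2 * PI)), Hc.
  - apply Hinj. rewrite Hsig. unfold Phi. rewrite Hint. ring.
Qed.

Lemma cos_ge_of_abs_le y b : Rabs y <= b -> b <= PI -> cos b <= cos y.
Proof.
  intros Hy Hb.
  replace (cos y) with (cos (Rabs y)).
  - apply cos_decr_1; generalize (Rabs_pos y); lra.
  - unfold Rabs; destruct (Rcase_abs y); [apply cos_neg|reflexivity].
Qed.

Theorem theorem2p3 (alpha : R) (zeta_c zeta_b : C) (L : R) (phi : R -> R)
  (Halpha : 0 < alpha < 1)
  (Hzeta : zeta_c <> zeta_b)
  (HL : 0 < L)
  (HC1 : C1_on_R phi)
  (Hper : forall s : R, phi (s + L) = phi s)
  (Hpos : forall s : R, 0 < phi s)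
  (Hint : RInt phi 0 L = 1)
  (Hmax : forall s : R, 0 <= s <= L -> Rabs (Derive phi s / phi s ^ 2) <= 2 * PI) :
  exists (r : R) (f f' : C -> C),
    0 < r /\
    class_F alpha zeta_c (ray_point zeta_c zeta_b r) f f' /\
    T_equals f' L phi.
Proof.
  assert (HPI := PI_RGT_0). assert (HPI3 := PI2_3_2).
  destruct (boundary_speed L phi HL HC1 Hper Hpos Hint Hmax) as [rho [sigma [Hrho [Hexp [Harc HsigL]]]]].
  destruct (schwarz_extension rho alpha Hrho Halpha) as [H [HH [Hin [Hre [Him [M HM]]]]]].
  assert (HM0 : 0 <= M) by (eapply Rle_trans; [apply Cmod_ge_0|apply (HM (RtoC 0))]).
  set (G := fun z => cexp (H z)).
  assert (HG : holder_d (fun _ => True) alpha G).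
  { destruct HH as [K [HK HHK]]. destruct (cexp_lip M HM0) as [K' [HK' Hlip]].
    exists (K' * K). split; [now apply Rmult_lt_0_compat|]. intros z w d _ _ Hd Hzw.
    eapply Rle_trans; [apply Hlip; apply HM|]. rewrite Rmult_assoc.
    apply Rmult_le_compat_l; [lra|]. now apply HHK. }
  assert (Hq : quad_diff_disc G (fun z => schwarz_deriv rho z * cexp (schwarz rho z))%C).
  { apply (quad_diff_ext (fun z => cexp (schwarz rho z))).
    - intros z Hz. unfold G. now rewrite Hin.
    - apply (quad_diff_cexp _ _ M HM0); [|now apply schwarz_quad_diff].
      intros z Hz. rewrite <- Hin by exact Hz. apply HM. }
  assert (HB : forall z, Cmod (G z) <= exp M) by (intros z; apply Cmod_cexp_le, HM).
  (* exp(-M) bounds exp(Re H) from below. The cosine factor comes from |Im H| <= 2 - pi^2/18 <= 3/2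
     < pi/2, where pi >= 3 suffices. *)
  set (c := exp (- M) * cos (3 / 2)).
  assert (Hcos : 0 < cos (3 / 2)) by (apply cos_gt_0; lra).
  assert (Hc0 : 0 < c) by (apply Rmult_lt_0_compat; [apply exp_pos|exact Hcos]).
  assert (Hc : forall z, c <= fst (G z)).
  { intros z. unfold G, cexp, c; simpl.
    assert (Hf := Rle_trans _ _ _ (Cmod_fst (H z)) (HM z)). apply Rabs_le_between in Hf.
    apply Rmult_le_compat; [left; apply exp_pos|lra|apply exp_le_compat; lra|].
    apply cos_ge_of_abs_le; [|lra]. specialize (Him z).
    assert (9 <= PI ^ 2) by (simpl; nra). lra. }
  assert (Hexpand := radial_primitive_expanding_closed alpha G _ c (exp M) (proj1 Halpha) HG Hq HB Hc Hc0).
  assert (H0 : radial_primitive G (RtoC 0) = RtoC 0) by (unfold radial_primitive; ring).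
  set (I := radial_primitive G (RtoC 1)).
  assert (HI : 0 < Cmod I).
  { assert (E := Hexpand (RtoC 1) (RtoC 0)). unfold closed_unit_disc in E. rewrite Cmod_1, Cmod_0, H0 in E.
    specialize (E ltac:(lra) ltac:(lra)). fold I in E.
    replace (1 - 0)%C with (RtoC 1) in E by ring. rewrite Cmod_1 in E.
    replace (I - 0)%C with I in E by ring. lra. }
  assert (Hb : 0 < Cmod (zeta_b - zeta_c)).
  { apply Cmod_gt_0. intros E. apply Hzeta. replace zeta_b with (zeta_b - zeta_c + zeta_c)%C by ring. rewrite E; ring. }
  (* The prescribed boundary speed determines the modulus of [I], the primitive at 1. This [r]
     places the target at that distance from [zeta_c], so the factor [u] carrying [I] to the target
     has modulus 1 and leaves |f'| unchanged. *)
  set (r := Cmod I / Cmod (zeta_b - zeta_c)).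
  assert (Hr : 0 < r) by (apply Rdiv_lt_0_compat; assumption).
  set (u := (RtoC r * (zeta_b - zeta_c) / I)%C).
  assert (Hu : Cmod u = 1).
  { unfold u. rewrite Cmod_div by (now apply Cmod_gt_0). rewrite Cmod_mult, Cmod_R, Rabs_pos_eq by lra.
    unfold r. field. split; lra. }
  assert (Hu0 : u <> RtoC 0) by (apply Cmod_gt_0; lra).
  assert (Hspeed : forall t, Cmod (u * G (cis t)) = exp (rho t)).
  { intros t. rewrite Cmod_mult, Hu. unfold G. rewrite Cmod_cexp, Hre. ring. }
  exists r, (fun z => zeta_c + u * radial_primitive G z)%C, (fun z => u * G z)%C.
  split; [exact Hr|split; [split; [split; [|split]|split; [|split; [|split]]]|split]].
  - intros z Hz. unfold unit_disc in Hz.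
    set (r1 := (1 + Cmod z) / 2). assert (Hz0 := Cmod_ge_0 z).
    assert (Hr1 : 0 < r1 < 1 /\ Cmod z < r1) by (unfold r1; lra). destruct Hr1 as [Hr1 Hzr1].
    destruct (radial_primitive_quad alpha G _ r1 (proj1 Halpha) HG Hq Hr1) as [M1 [HM1 HM1']].
    apply (is_derive_C_quad _ _ _ M1 (r1 - Cmod z)); [lra|].
    intros w Hw.
    replace (zeta_c + u * radial_primitive G w - (zeta_c + u * radial_primitive G z) - (w - z) * (u * G z))%C
      with (u * (radial_primitive G w - radial_primitive G z - (w - z) * G z))%C by ring.
    rewrite Cmod_mult, Hu, Rmult_1_l. apply HM1'; [|lra].
    generalize (Cmod_le_plus_minus w z); lra.
  - assert (Hcont : forall z, closed_unit_disc z ->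
      continuous (T := C_UniformSpace) (U := C_UniformSpace) (fun z => zeta_c + u * radial_primitive G z)%C z).
    { intros z Hz. apply continuous_C_eps. intros e He.
      destruct (radial_primitive_modulus alpha G (exp M) (proj1 Halpha) HG HB) as [K [HK HKm]].
      destruct (Rpower_small alpha K (e / 2) (proj1 Halpha) HK ltac:(lra)) as [d [Hd Hde]].
      assert (HeM := exp_pos M).
      set (d' := Rmin d (e / (2 * exp M))).
      assert (Hd' : 0 < d') by (apply Rmin_pos; [exact Hd|apply Rdiv_lt_0_compat; lra]).
      exists d'. split; [exact Hd'|]. intros w Hw.
      replace (zeta_c + u * radial_primitive G w - (zeta_c + u * radial_primitive G z))%C
        with (u * (radial_primitive G w - radial_primitive G z))%C by ring.
      rewrite Cmod_mult, Hu, Rmult_1_l.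
      eapply Rle_lt_trans; [apply (HKm w z d'); [exact Hz|exact Hd'|lra]|].
      assert (Hp : Rpower d' alpha <= Rpower d alpha) by (apply Rle_Rpower_l; [lra|]; split; [exact Hd'|apply Rmin_l]).
      assert (H2 : d' * exp M <= e / (2 * exp M) * exp M) by (apply Rmult_le_compat_r; [lra|apply Rmin_r]).
      replace (e / (2 * exp M) * exp M) with (e / 2) in H2 by (field; lra).
      assert (K * Rpower d' alpha <= K * Rpower d alpha) by (apply Rmult_le_compat_l; lra). lra. }
    (* Continuity relative to the closed disc is deduced from continuity in the whole plane,
       available because [G] is defined and Hoelder everywhere. *)
    intros z Hz P HP. specialize (Hcont z Hz P HP).
    unfold filtermap, within in *. revert Hcont. apply filter_imp. auto.
  - destruct HG as [K [HK HGK]]. exists K. intros z w Hz Hw Hzw.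
    replace (u * G z - u * G w)%C with (u * (G z - G w))%C by ring.
    rewrite Cmod_mult, Hu, Rmult_1_l. apply HGK; auto; [|lra].
    apply Cmod_gt_0. intros E. apply Hzw. replace z with (z - w + w)%C by ring. rewrite E; ring.
  - intros z w Hz Hw E.
    assert (Ep : (radial_primitive G z - radial_primitive G w)%C = RtoC 0).
    { replace (radial_primitive G z - radial_primitive G w)%C
        with (((zeta_c + u * radial_primitive G z) - (zeta_c + u * radial_primitive G w)) / u)%C by (field; exact Hu0).
      rewrite E. field; exact Hu0. }
    specialize (Hexpand z w Hz Hw). rewrite Ep, Cmod_0 in Hexpand.
    assert (E0 : (z - w)%C = RtoC 0).
    { apply Cmod_eq_0. assert (Hp := Cmod_ge_0 (z - w)). nra. }
    replace z with (z - w + w)%C by ring. rewrite E0; ring.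
  - intros z _. apply Cmod_gt_0. rewrite Cmod_mult, Hu. unfold G. rewrite Cmod_cexp.
    generalize (exp_pos (fst (H z))); lra.
  - rewrite H0. ring.
  - unfold ray_point. fold I. unfold u. field. now apply Cmod_gt_0.
  - unfold arclength. rewrite (RInt_ext _ (fun t => exp (rho t))) by (intros t _; apply Hspeed).
    rewrite Harc. exact HsigL.
  - intros theta _. unfold arclength. rewrite (RInt_ext _ (fun t => exp (rho t))) by (intros t _; apply Hspeed).
    rewrite Harc, Hspeed, Hexp. field. specialize (Hpos (sigma theta)). split; lra.
Qed.
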